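(* Consider the $3$-stage partitioned Runge--Kutta method $(P_Z,\widehat{P}_U)$ with coefficients as follows. $P_Z$ has $$(a_{ij})=\begin{pmatrix}0&0&0\\ 0&\frac14&\frac14-\frac{\sqrt3}{6}\\ 0&\frac14+\frac{\sqrt3}{6}&\frac14\end{pmatrix},\qquad (b_i)=\left(0,\tfrac12,\tfrac12\right),$$ (the $2$-stage Gauss--Legendre method of order $4$ enlarged by a fictitious first stage), and $\widehat{P}_U$ is the explicit method with $$(\widehat a_{ij})=\begin{pmatrix}0&0&0\\ \frac12-\frac{\sqrt3}{6}&0&0\\ -\frac{1}{3-\sqrt3}&\frac{2}{3-\sqrt3}&0\end{pmatrix},\qquad (\widehat b_i)=\left(0,\tfrac12,\tfrac12\right).$$ Then the partitioned Runge--Kutta method $(P_Z,\widehat{P}_U)$ has order of accuracy $3$, and the numerical integrator $P_Z$ is symplectic.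
   Context: Partitioned Runge--Kutta method: let $z$ and $v$ take values in finite-dimensional real vector spaces and consider a partitioned autonomous system $\dot z=g(z,v)$, $\dot v=f(z,v)$ with sufficiently smooth $g,f$. Given an $s$-stage Runge--Kutta method $P_Z$ with weights $b_i$ and coefficients $a_{ij}$ ($1\le i,j\le s$) and an $s$-stage explicit Runge--Kutta method $\widehat{P}_U$ with weights $\widehat b_i$ and coefficients $\widehat a_{ij}$ ($1\le j<i\le s$, with $\widehat a_{ij}=0$ for $j\ge i$), the partitioned method $(P_Z,\widehat P_U)$ with time step $\Delta t$ maps $(z_0,v_0)$ to $$z_1=z_0+\Delta t\sum_{i=1}^s b_i k_i,\qquad v_1=v_0+\Delta t\sum_{i=1}^s\widehat b_i\widehat k_i,$$ $$k_i=g\Big(z_0+\Delta t\sum_{j=1}^{s}a_{ij}k_j,\;v_0+\Delta t\sum_{j=1}^{i-1}\widehat a_{ij}\widehat k_j\Big),\qquad \widehat k_i=f\Big(z_0+\Delta t\sum_{j=1}^{s}a_{ij}k_j,\;v_0+\Delta t\sum_{j=1}^{i-1}\widehat a_{ij}\widehat k_j\Big).$$ Order of accuracy: the method has order $p$ if, for all sufficiently smooth $g,f$ and all initial values, the error after one step satisfies $(z_1,v_1)-(z(\Delta t),v(\Delta t))=O(\Delta t^{p+1})$ as $\Delta t\to0$, where $(z(t),v(t))$ is the exact solution with $(z(0),v(0))=(z_0,v_0)$. Symplectic: the Runge--Kutta method $P_Z$ is symplectic if, whenever it is applied to a canonical Hamiltonian system $\dot y=J\nabla H(y)$ on $\mathbb{R}^{2n}$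 with $H$ smooth and $J=\begin{pmatrix}0&I_n\\-I_n&0\end{pmatrix}$, its one-step map $y_0\mapsto y_1$ is symplectic, i.e. its Jacobian $M$ satisfies $M^\top JM=J$ (for $\Delta t$ small enough that the step is well defined). *)

(* Defs.v *)
From mathcomp Require Import all_boot all_order all_algebra.
From mathcomp Require Import all_classical all_reals all_analysis.

Set Implicit Arguments.
Unset Strict Implicit.
Unset Printing Implicit Defensive.

Import Order.TTheory GRing.Theory Num.Theory.
Import numFieldNormedType.Exports.

Local Open Scope classical_set_scope.
Local Open Scope ring_scope.

(* Continuous differentiability of order N.  Between finite-dimensional spaces,
   where it is used below, the differential is C^N as a map into linear maps iff
   each of its evaluations at a fixed vector u is. *)
Fixpoint Cn (R : realType) (V W : normedModType R) (N : nat) (f : V -> W) :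
    Prop :=
  match N with
  | 0 => continuous f
  | N'.+1 => (forall x, differentiable f x) /\
             (forall u, Cn N' (fun x => 'd f x u))
  end.

Definition Cinfty (R : realType) (V W : normedModType R) (f : V -> W) : Prop :=
  forall N, Cn N f.

Section RungeKutta.
Context {R : realType} {s : nat}.

(* The relation "y1 is obtained from y0 by one step of size h with stages k". *)
Definition rk_step (V : lmodType R) (a : 'M[R]_s) (b : 'rV[R]_s)
    (f : V -> V) (h : R) (y0 : V) (k : 'I_s -> V) (y1 : V) : Prop :=
  (forall i, k i = f (y0 + h *: \sum_(j < s) a i j *: k j)) /\
  y1 = y0 + h *: \sum_(i < s) b 0 i *: k i.

(* The hatted method is explicit: only the entries of a' strictly below the
   diagonal are used. *)
Definition prk_step (V W : lmodType R)
    (a : 'M[R]_s) (b : 'rV[R]_s) (a' : 'M[R]_s) (b' : 'rV[R]_s)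
    (g : V * W -> V) (f : V * W -> W) (h : R) (y0 : V * W)
    (k : 'I_s -> V) (k' : 'I_s -> W) (y1 : V * W) : Prop :=
  let stage i := (y0.1 + h *: \sum_(j < s) a i j *: k j,
                  y0.2 + h *: \sum_(j < s | (j < i)%N) a' i j *: k' j) in
  [/\ forall i, k i = g (stage i),
      forall i, k' i = f (stage i) &
      y1 = (y0.1 + h *: \sum_(i < s) b 0 i *: k i,
            y0.2 + h *: \sum_(i < s) b' 0 i *: k' i)].

(* Phi h y is the result of one step of size h from y, for h near 0 and y near
   y0.  For a nonlinear right-hand side the implicit stage equations may also
   have spurious solutions, which blow up as h -> 0; continuity of the stages
   at (0, y0), where the stage equations force the value of the right-hand
   side at y0, selects the solution that defines the method. *)
Definition rk_map (V : normedModType R) (a : 'M[R]_s) (b : 'rV[R]_s)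
    (f : V -> V) (y0 : V) (Phi : R -> V -> V) : Prop :=
  exists k : 'I_s -> R * V -> V,
    (forall i, {for (0, y0), continuous (k i)}) /\
    \forall p \near ((0 : R), y0),
      rk_step a b f p.1 p.2 (fun i => k i p) (Phi p.1 p.2).

Definition prk_map (V W : normedModType R)
    (a : 'M[R]_s) (b : 'rV[R]_s) (a' : 'M[R]_s) (b' : 'rV[R]_s)
    (g : V * W -> V) (f : V * W -> W) (y0 : V * W)
    (Phi : R -> V * W -> V * W) : Prop :=
  exists (k : 'I_s -> R * (V * W) -> V) (k' : 'I_s -> R * (V * W) -> W),
    [/\ forall i, {for (0, y0), continuous (k i)},
        forall i, {for (0, y0), continuous (k' i)} &
        \forall p \near ((0 : R), y0),
          prk_step a b a' b' g f p.1 p.2 (fun i => k i p) (fun i => k' i p)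
            (Phi p.1 p.2)].

End RungeKutta.

Definition exact_solution (R : realType) (V W : normedModType R)
    (g : V * W -> V) (f : V * W -> W) (y0 : V * W) (z : R -> V) (v : R -> W) :
    Prop :=
  (z 0, v 0) = y0 /\
  \forall t \near (0 : R), is_derive (t : R) (1 : R) z (g (z t, v t)) /\
                           is_derive (t : R) (1 : R) v (f (z t, v t)).

(* "Sufficiently smooth" is "C^N for some N that depends on the method only".
   The first clause says that the step is well defined for small h. *)
Definition prk_order (R : realType) (s : nat)
    (a : 'M[R]_s) (b : 'rV[R]_s) (a' : 'M[R]_s) (b' : 'rV[R]_s) (p : nat) :
    Prop :=
  exists N : nat, forall (m n : nat)
    (g : 'rV[R]_m * 'rV[R]_n -> 'rV[R]_m)
    (f : 'rV[R]_m * 'rV[R]_n -> 'rV[R]_n),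
    Cn N g -> Cn N f ->
    forall y0 : 'rV[R]_m * 'rV[R]_n,
      (exists Phi, prk_map a b a' b' g f y0 Phi) /\
      (forall Phi z v, prk_map a b a' b' g f y0 Phi ->
        exact_solution g f y0 z v ->
        (fun h : R => Phi h y0 - (z h, v h)) =O_ ((0 : R)^')
        (fun h : R => h ^+ p.+1)).

Section Symplectic.
Context {R : realType}.

Definition canonical_J (n : nat) : 'M[R]_(n + n) :=
  block_mx 0 1%:M (- 1%:M) 0.

Definition symplectic_mx (n : nat) (M : 'M[R]_(n + n)) : Prop :=
  M^T *m canonical_J n *m M = canonical_J n.

Definition gradient (n : nat) (H : 'rV[R]_n -> R) (y : 'rV[R]_n) : 'cV[R]_n :=
  \col_i 'D_(delta_mx 0 i) H y.

Definition hamiltonian_field (n : nat) (H : 'rV[R]_(n + n) -> R)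
    (y : 'rV[R]_(n + n)) : 'rV[R]_(n + n) :=
  (canonical_J n *m gradient H y)^T.

(* The library's [jacobian] acts on row vectors from the right, so the usual
   Jacobian matrix, acting on column vectors, is its transpose. *)
Definition symplectic_at (n : nat) (F : 'rV[R]_(n + n) -> 'rV[R]_(n + n))
    (y : 'rV[R]_(n + n)) : Prop :=
  differentiable F y /\ symplectic_mx (jacobian F y)^T.

Definition rk_symplectic (s : nat) (a : 'M[R]_s) (b : 'rV[R]_s) : Prop :=
  forall (n : nat) (H : 'rV[R]_(n + n) -> R), Cinfty H ->
  forall y0 : 'rV[R]_(n + n),
    (exists Phi, rk_map a b (hamiltonian_field H) y0 Phi) /\
    (forall Phi, rk_map a b (hamiltonian_field H) y0 Phi ->
      \forall p \near ((0 : R), y0), symplectic_at (Phi p.1) p.2).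

End Symplectic.

Section Coefficients.
Variable R : realType.

Definition mx_of_rows (m n : nat) (rows : seq (seq R)) : 'M[R]_(m, n) :=
  \matrix_(i < m, j < n) (nth [::] rows i)`_j.

Let sqrt3 : R := Num.sqrt 3.

Definition aZ : 'M[R]_3 := mx_of_rows 3 3
  [:: [:: 0; 0;                 0];
      [:: 0; 1 / 4;             1 / 4 - sqrt3 / 6];
      [:: 0; 1 / 4 + sqrt3 / 6; 1 / 4]].

Definition bZ : 'rV[R]_3 := mx_of_rows 1 3 [:: [:: 0; 1 / 2; 1 / 2]].

Definition aU : 'M[R]_3 := mx_of_rows 3 3
  [:: [:: 0;                   0;               0];
      [:: 1 / 2 - sqrt3 / 6;   0;               0];
      [:: - (1 / (3 - sqrt3)); 2 / (3 - sqrt3); 0]].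

Definition bU : 'rV[R]_3 := mx_of_rows 1 3 [:: [:: 0; 1 / 2; 1 / 2]].

End Coefficients.

(* Main.v *)
Require Import Defs.
From HB Require Import structures.
From mathcomp Require Import all_boot all_order all_algebra.
From mathcomp Require Import all_classical all_reals all_analysis.
From mathcomp Require Import ring lra.

(* Order.  Concatenating both components turns the partitioned method into a
   single Runge-Kutta method whose coefficients depend on the coordinate.  The
   stages are only known to be continuous at h = 0, so they are expanded by
   substituting the stage equations into themselves: an error O(h^n) in the
   stages gives O(h^(n+1)) in the stage values, and the second order Taylor
   formula of the vector field turns it back into O(h^(n+1)) in the stages.
   The same bootstrapping, with integration in place of multiplication by h,
   expands the exact solution, and the expansions agree up to O(h^4) by the
   order conditions.

   Symplecticity.  Near h = 0 the stage equations are contractive, hence the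
   stages are locally unique and Lipschitz in the initial value, and their
   differentials solve the linearized stage equations.  The differential of a
   Hamiltonian field is infinitesimally symplectic by the symmetry of second
   derivatives, and b_i a_ij + b_j a_ji = b_i b_j makes the step preserve the
   symplectic form. *)

Set Implicit Arguments.
Unset Strict Implicit.
Unset Printing Implicit Defensive.

Import Order.TTheory GRing.Theory Num.Theory.
Import Num.Def numFieldNormedType.Exports.

Local Open Scope classical_set_scope.
Local Open Scope ring_scope.

(** * Differential calculus in coordinates *)

Section Norms.
Context {R : realType}.

Lemma mx_coord_le (m n : nat) (M : 'M[R]_(m, n)) i j : `|M i j| <= `|M|.
Proof.
rewrite [leRHS]/normr /= mx_normrE; apply/bigmax_geP; right => /=.
by exists (i, j).
Qed.

Lemma mx_norm_le (m n : nat) (M : 'M[R]_(m, n)) c :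
  0 <= c -> (forall i j, `|M i j| <= c) -> `|M| <= c.
Proof.
by move=> c0 Mc; rewrite [leLHS]/normr /= mx_normrE; apply/bigmax_leP; split.
Qed.

Lemma row_norm_le (m n : nat) (M : 'M[R]_(m, n)) i : `|row i M| <= `|M|.
Proof. by apply: mx_norm_le => // a j; rewrite mxE mx_coord_le. Qed.

Lemma mx_norm_rows (m n : nat) (M : 'M[R]_(m, n)) c :
  0 <= c -> (forall i, `|row i M| <= c) -> `|M| <= c.
Proof.
move=> c0 Mc; apply: mx_norm_le => // i j.
by have := mx_coord_le (row i M) 0 j; rewrite mxE => /le_trans; apply.
Qed.

Lemma linear_delta (n : nat) (W : lmodType R) (f : {linear 'rV[R]_n -> W}) u :
  f u = \sum_j u 0 j *: f (delta_mx 0 j).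
Proof.
rewrite {1}[u]row_sum_delta linear_sum; apply: eq_bigr => j _.
by rewrite linearZ.
Qed.

Lemma linear_rV_continuous (n : nat) (W : normedModType R)
  (f : {linear 'rV[R]_n -> W}) : continuous f.
Proof.
rewrite (_ : (f : _ -> _) = fun u => \sum_j u 0 j *: f (delta_mx 0 j));
  last first.
  by apply/funext => u; exact: linear_delta.
apply: continuous_big => [|j _ x]; first exact: add_continuous.
by apply: (cvgZr_tmp (@coord_continuous R 1 n 0 j x)).
Qed.

End Norms.

Section LineDerivative.
Context {R : realType} {V W : normedModType R}.

Lemma is_derive_line (F : V -> W) x u (t : R) :
  differentiable F (x + t *: u) ->
  is_derive t (1 : R) (fun s : R => F (x + s *: u)) ('d F (x + t *: u) u).
Proof.
move=> dF.
have dl : is_diff t (fun s : R => x + s *: u) (fun s => s *: u).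
  have := is_diffD (is_diff_cst x t) (is_diff_scalel t u).
  by rewrite add0r.
have dFl : is_diff t (F \o (fun s : R => x + s *: u))
    ('d F (x + t *: u) \o (fun s => s *: u)).
  by apply: is_diff_comp; exact: differentiableP.
apply: DeriveDef; first by apply: diff_derivable; exact: ex_diff.
rewrite deriveE; last exact: ex_diff.
by rewrite diff_val /= scale1r.
Qed.

End LineDerivative.

Section MeanValue.
Context {R : realType}.

Lemma MVT01 (f df : R -> R) :
  (forall t : R, 0 <= t <= 1 -> is_derive t (1 : R) f (df t)) ->
  exists2 t : R, 0 <= t <= 1 & f 1 - f 0 = df t.
Proof.
move=> dfE.
have cf : {within `[0, 1], continuous f}.
  apply: derivable_within_continuous => x /=; rewrite in_itv /= => x01.
  by have := dfE x x01 => -[].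
have [x + ->] := @MVT_segment _ f df 0 1 ler01 (fun x xI =>
  dfE x (subset_itv_oo_cc xI)) cf.
by rewrite in_itv /= subr0 mulr1 => x01; exists x.
Qed.

(** The intermediate point depends on the entry. Since the norm is the maximum of the entries, the
    bound [c] nevertheless passes to the whole matrix without loss. *)
Lemma mx_mean_value m n (f df : R -> 'M[R]_(m, n)) (c : R) :
  0 <= c ->
  (forall (t : R) i j, 0 <= t <= 1 ->
     is_derive t (1 : R) (fun s => f s i j) (df t i j)) ->
  (forall t : R, 0 <= t <= 1 -> `|df t| <= c) ->
  `|f 1 - f 0| <= c.
Proof.
move=> c0 dfE dfc; apply: mx_norm_le => // i j.
have [t t01 tE] := MVT01 (fun t => dfE t i j).
by rewrite !mxE tE (le_trans (mx_coord_le _ _ _)) ?dfc.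
Qed.

End MeanValue.

Section Coordinates.
Context {R : realType} {V : normedModType R}.

Lemma is_diff_coord m n (F : V -> 'M[R]_(m, n)) x i j :
  differentiable F x ->
  differentiable (fun y => F y i j) x /\
  forall u, 'd (fun y => F y i j) x u = 'd F x u i j.
Proof.
move=> dF.
have @C : {linear 'M[R]_(m, n) -> R}.
  by exists (fun N : 'M[R]_(m, n) => N i j); do 2![eexists]; do ?[constructor];
     rewrite ?mxE// => ? *; rewrite ?mxE//; move=> ?; rewrite !mxE.
have Cc : continuous C by exact: (@coord_continuous R m n i j).
have dC y : differentiable C y by exact: linear_differentiable.
split; first exact: (differentiable_comp dF (dC _)).
move=> u; have := diff_comp dF (dC (F x)) => /(congr1 (fun f => f u)) /= ->.
by have /(congr1 (fun f => f ('d F x u))) /= -> := diff_lin (F x) Cc.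
Qed.

End Coordinates.

(** Bundles a function whose linearity is only a proved fact, so that the rewriting rules for linear
    maps apply to it. *)
Lemma linear_pack (R : pzRingType) (V W : lmodType R) (f : V -> W) :
  linear f -> exists L : {linear V -> W}, f = L.
Proof.
move=> lf.
pose fL := GRing.isLinear.Build _ _ _ _ f lf.
pose L : {linear V -> W} := HB.pack f fL.
by exists L.
Qed.

Section SecondDifferential.
Context {R : realType} {V W : normedModType R}.

(** The second differential: [u] is the direction of the first differentiation and [v] that of the
    second. *)
Definition diff2 (F : V -> W) (x u v : V) : W := 'd (fun z => 'd F z u) x v.

(** Linearity in [v] is that of a differential. Linearity in [u] comes from differentiating the
    identity ['d F z (a *: u + u') = a *: 'd F z u + 'd F z u'] in [z]. *)
Lemma diff2_linear_l (F : V -> W) x v :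
  (forall u, differentiable (fun z => 'd F z u) x) ->
  linear (fun u => diff2 F x u v).
Proof.
move=> dF a u u'; rewrite /diff2.
have -> : (fun z => 'd F z (a *: u + u')) =
    a *: (fun z => 'd F z u) + (fun z => 'd F z u').
  by apply/funext => z; rewrite linearP.
have dau : differentiable (a *: (fun z =>
  'd F z u)) x by exact: differentiableZ.
apply: (etrans (congr1 (fun f => f v) (diffD dau (dF u')))) => /=.
congr (_ + _); exact: (congr1 (fun f => f v) (diffZ a (dF u))).
Qed.

End SecondDifferential.

(** Reduces bounds on the second differential, uniform in [u] and [v], to finitely many second
    partial derivatives. *)
Lemma diff2_delta (R : realType) d (W : normedModType R)
    (F : 'rV[R]_d -> W) x u v :
  (forall u, differentiable (fun z => 'd F z u) x) ->
  diff2 F x u v =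
  \sum_i u 0 i *: \sum_j v 0 j *: diff2 F x (delta_mx 0 i) (delta_mx 0 j).
Proof.
move=> dF.
have [L LE] := linear_pack (diff2_linear_l v dF).
rewrite -[LHS]/((fun w => diff2 F x w v) u) LE linear_delta.
apply: eq_bigr => i _; congr (_ *: _).
rewrite -LE; exact: (linear_delta ('d (fun z => 'd F z (delta_mx 0 i)) x) v).
Qed.

Lemma segment_ball (R : realType) d (y0 x y : 'rV[R]_d) (r t : R) :
  `|x - y0| < r -> `|y - y0| < r -> 0 <= t <= 1 ->
  `|y + t *: (x - y) - y0| < r.
Proof.
move=> xr yr /andP[t0 t1].
have -> : y + t *: (x - y) - y0 = t *: (x - y0) + (1 - t) *: (y - y0).
  by apply/rowP => j; rewrite !mxE; ring.
rewrite (le_lt_trans (ler_normD _ _))// !normrZ ger0_norm//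
  ger0_norm ?subr_ge0//.
(* The strict inequality is carried by the term with factor [t], so [t = 0] has to be treated
   apart. *)
have [->|tn0] := eqVneq t 0; first by rewrite mul0r add0r subr0 mul1r.
have tp : 0 < t by rewrite lt_neqAle eq_sym tn0.
rewrite -[ltRHS](_ : t * r + (1 - t) * r = r); last by ring.
by rewrite ltr_leD// ?ltr_pM2l// ler_wpM2l ?subr_ge0// ltW.
Qed.

Lemma norm_le_dist (R : realType) (V : normedModType R) (a b : V) c :
  `|b - a| <= c -> `|a| <= `|b| + c.
Proof.
by move=> h; rewrite -lerBlDl (le_trans (lerB_dist _ _))// distrC.
Qed.

(** * Local Lipschitz bounds and the second order Taylor formula *)

Section LocalBounds.
Context {R : realType} (d e : nat).

(* A single small [r] gives both the radius and the bound [r^-1], so that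
   finitely many such bounds can be intersected as a filter. *)
Lemma C1_diff_bound (F : 'rV[R]_d -> 'rV[R]_e) (y0 : 'rV[R]_d) : Cn 1 F ->
  \forall r \near 0^'+, forall x v, `|x - y0| < r -> `|'d F x v| <= r^-1 * `|v|.
Proof.
move=> [dF cF].
(* By continuity each partial derivative stays within 1 of its value at [y0], so [C] bounds the
   differential near [y0]. Taking [r] below the inverse of [C + 1] gives [C <= r^-1]. *)
pose C := \sum_(j < d) (`|'d F y0 (delta_mx 0 j)| + 1).
have C0 : 0 <= C by apply: sumr_ge0 => j _; rewrite addr_ge0.
have /filter_forall : forall j : 'I_d, \forall x \near y0,
    `|'d F x (delta_mx 0 j)| <= `|'d F y0 (delta_mx 0 j)| + 1.
  move=> j; have /cvgrPdist_le /(_ 1 ltr01) := cF (delta_mx 0 j) y0.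
  by apply: filterS => x; exact: norm_le_dist.
move=> /nbhs_normP [s /= s0 sP].
near=> r => x v xr.
have Cr : C <= r^-1.
  have r0 : 0 < r by near: r; exact: nbhs_right_gt.
  rewrite (@le_trans _ _ (C + 1)) ?lerDl//
    -[leLHS]invrK lef_pV2 ?posrE ?invr_gt0 ?ltr_wpDl//.
  by near: r; apply: nbhs_right_le; rewrite invr_gt0 ltr_wpDl.
rewrite linear_delta (le_trans (ler_norm_sum _ _ _))//.
rewrite (@le_trans _ _ (C * `|v|))//; last by rewrite ler_wpM2r.
rewrite mulr_suml ler_sum// => j _; rewrite normrZ mulrC ler_pM//.
  have rs : r < s by near: r; exact: nbhs_right_lt.
  by apply: sP => /=; rewrite distrC (lt_trans xr).
exact: mx_coord_le.
Unshelve. all: by end_near. Qed.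

Lemma diff_bound_lipschitz (F : 'rV[R]_d -> 'rV[R]_e) y0 (r c : R) :
  (forall x, differentiable F x) -> 0 <= c ->
  (forall x v, `|x - y0| < r -> `|'d F x v| <= c * `|v|) ->
  forall x y, `|x - y0| < r -> `|y - y0| < r -> `|F x - F y| <= c * `|x - y|.
Proof.
move=> dF c0 dFc x y xr yr.
have := @mx_mean_value _ _ _ (fun t => F (y + t *: (x - y)))
  (fun t => 'd F (y + t *: (x - y)) (x - y)) (c * `|x - y|).
rewrite scale1r scale0r addr0 subrKC; apply.
- by rewrite mulr_ge0.
- move=> t i j t01.
  have [dFi dE] := is_diff_coord i j (dF (y + t *: (x - y))).
  by have := is_derive_line dFi; rewrite dE.
- by move=> t t01; apply: dFc; exact: segment_ball.
Qed.

(** Each second partial derivative is C^1, hence Lipschitz near [y0] with constant [r^-1]. There are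
    [d * d] of them, which gives [c]. *)
Lemma diff2_lipschitz (F : 'rV[R]_d -> 'rV[R]_e) (y0 : 'rV[R]_d) : Cn 3 F ->
  exists2 c : R, 0 <= c & \forall r \near 0^'+, forall x u, `|x - y0| < r ->
    `|diff2 F x u u - diff2 F y0 u u| <= c * r^-1 * (`|u| ^+ 2 * `|x - y0|).
Proof.
move=> [_ C2]; exists (d%:R * d%:R) => //.
have d2F x u : differentiable (fun z => 'd F z u) x by case: (C2 u).
pose E i : 'rV[R]_d := delta_mx 0 i.
have /filter_forall : forall i : 'I_d, \forall r \near 0^'+,
  forall (j : 'I_d) x v,
    `|x - y0| < r ->
    `|'d (fun z => diff2 F z (E i) (E j)) x v| <= r^-1 * `|v|.
  move=> i; have h : forall j : 'I_d, \forall r \near 0^'+, forall x v,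
    `|x - y0| < r ->
    `|'d (fun z => diff2 F z (E i) (E j)) x v| <= r^-1 * `|v|.
    by move=> j; apply: C1_diff_bound; case: (C2 (E i)) => _ /(_ (E j)).
  exact: filter_forall h.
apply: filterS2 (nbhs_right_gt 0) => r r0 rP x u xr.
rewrite !diff2_delta// -sumrB (le_trans (ler_norm_sum _ _ _))//.
(* The factor [d%:R] becomes a sum of ones over ['I_d], so that the two sides are compared term by
   term. *)
rewrite -!mulrA -[X in X%:R * _]card_ord -sum1_card natr_sum mulr_suml
  ler_sum// => i _.
rewrite -scalerBr normrZ mul1r.
rewrite [leRHS](_ : _ = `|u| * (d%:R * (r^-1 * (`|u| * `|x - y0|))));
  last by ring.
apply: ler_pM => //.
  by have := mx_coord_le u 0 i.
rewrite -sumrB (le_trans (ler_norm_sum _ _ _))//.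
rewrite -[X in X%:R * _]card_ord -sum1_card natr_sum mulr_suml ler_sum// => j _.
rewrite mul1r -scalerBr normrZ mulrCA; apply: ler_pM => //;
  first exact: mx_coord_le.
have dE : forall z, differentiable (fun z => diff2 F z (E i) (E j)) z.
  by move=> z; case: (C2 (E i)) => _ /(_ (E j)) [].
have rV : 0 <= r^-1 by rewrite invr_ge0 ltW.
have y0r : `|y0 - y0| < r by rewrite subrr normr0.
exact: (diff_bound_lipschitz dE rV (fun z v zr => rP i j z v zr) xr y0r).
Qed.

End LocalBounds.

(** [t *: l + t ^+ 2 *: (2^-1 *: q)] is a primitive of [l + t *: q]. The mean value bound is applied
    to [G] along the segment minus this primitive. *)
Lemma segment_taylor (R : realType) d e (G : 'rV[R]_d ->
  'rV[R]_e) y u l q (c : R) :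
  0 <= c -> (forall z, differentiable G z) ->
  (forall t : R, 0 <= t <= 1 -> `|'d G (y + t *: u) u - (l + t *: q)| <= c) ->
  `|G (y + u) - G y - (l + 2^-1 *: q)| <= c.
Proof.
move=> c0 dG dGc.
pose f := fun t : R => G (y + t *: u) - (t *: l + t ^+ 2 *: (2^-1 *: q)).
have -> : G (y + u) - G y - (l + 2^-1 *: q) = f 1 - f 0.
  by rewrite /f expr0n /= !scale0r !addr0 subr0 expr1n !scale1r addrAC.
apply: (@mx_mean_value _ _ _ f (fun t =>
  'd G (y + t *: u) u - (l + t *: q))) => //.
move=> t i j t01.
have [dGi dE] := is_diff_coord i j (dG (y + t *: u)).
have := is_derive_line dGi; rewrite dE => h.
rewrite (_ : (fun s => f s i j) = (fun t => G (y + t *: u) i j)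
    \- ((fun t => t * l i j) \+ (fun t => t ^+ 2 * (2^-1 * q i j))));
      last first.
  by apply/funext => z; rewrite /f !mxE.
apply: is_derive_eq; rewrite !mxE; congr (_ - (_ + _)).
  by rewrite scaler0 add0r /GRing.scale /= mulr1.
by rewrite scaler0 add0r /GRing.scale /=; field.
Qed.

Lemma C3_taylor (R : realType) d e (F : 'rV[R]_d ->
  'rV[R]_e) (y0 : 'rV[R]_d) : Cn 3 F ->
  exists2 c : R, 0 <= c & \forall x \near (0 : 'rV[R]_d),
    `|F (y0 + x) - F y0 - ('d F y0 x + 2^-1 *: diff2 F y0 x x)| <= c * `|x| ^+
      3.
Proof.
move=> F3; have [c c0 cP] := diff2_lipschitz y0 F3.
have dF x : differentiable F x by case: F3.
have d2F x u : differentiable (fun z => 'd F z u) x by case: F3 => _ /(_ u)[].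
have : \forall r \near (0 : R)^'+, 0 < r /\ forall x u, `|x - y0| < r ->
    `|diff2 F x u u - diff2 F y0 u u| <= c * r^-1 * (`|u| ^+ 2 * `|x - y0|).
  by near=> r; split; near: r => //; exact: nbhs_right_gt.
move=> /filter_ex[r [r0 rP]].
have cr0 : 0 <= c * r^-1 by rewrite mulr_ge0// invr_ge0 ltW.
exists (c * r^-1) => //.
apply/nbhs_normP; exists r => //= x /=; rewrite sub0r normrN => xr.
have cx0 : 0 <= c / r * `|x| ^+ 3 by rewrite mulr_ge0// exprn_ge0.
apply: segment_taylor => // t /andP[t0 t1].
have eqb (a b b' : 'rV[R]_e) : a - (b + b') = a - b - (b' + 2^-1 *: 0).
  by rewrite scaler0 addr0 opprD addrA.
rewrite eqb.
(* The same lemma, applied now to [z |-> 'd F z x] with increment [t *: x] and quadratic part 0,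
   verifies the derivative bound of its first application to [F]. *)
apply: (@segment_taylor _ _ _ (fun z =>
  'd F z x) y0 (t *: x) (t *: diff2 F y0 x x) 0
  (c / r * `|x| ^+ 3) cx0 (fun z => d2F z x)) => s /andP[s0 s1].
have -> : 'd (fun z => 'd F z x) (y0 + s *: (t *: x)) (t *: x) =
  t *: diff2 F (y0 + s *: (t *: x)) x x by rewrite linearZ.
have alg (a b : 'rV[R]_e) : `|t *: a - (t *: b + s *: 0)| = t * `|a - b|.
  by rewrite scaler0 addr0 -scalerBr normrZ ger0_norm.
rewrite alg.
have stx : `|y0 + s *: (t *: x) - y0| <= `|x|.
  rewrite [y0 + _]addrC addrK !normrZ !ger0_norm// mulrA ler_piMl//.
  by rewrite mulr_ile1.
rewrite (le_trans (ler_piMl _ t1))// (le_trans (rP _ _ (le_lt_trans stx xr)))//.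
rewrite ler_wpM2l// [leRHS]exprSr ler_wpM2l// exprn_ge0//.
Unshelve. all: by end_near. Qed.

(** * Symmetry of second derivatives *)

Section Schwarz.
Context {R : realType} {V : normedModType R}.

(** The mean value theorem is used twice: along [u] for the difference of [H] between two points
    that are [w] apart, then along [w] for the differential of [H] in direction [u]. *)
Lemma second_difference (H : V -> R) (y u w : V) : Cn 2 H ->
  exists2 x, `|x - y| <= `|u| + `|w| &
    H (y + u + w) - H (y + u) - H (y + w) + H y = diff2 H x u w.
Proof.
move=> [dH C1].
have d2H x v : differentiable (fun z => 'd H z v) x by case: (C1 v).
have [t t01 tE] : exists2 t : R, 0 <= t <= 1 &
    H (y + w + u) - H (y + u) - (H (y + w) - H y) =
    'd H (y + w + t *: u) u - 'd H (y + t *: u) u.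
  have := @MVT01 R (fun t => H (y + w + t *: u) - H (y + t *: u))
    (fun t => 'd H (y + w + t *: u) u - 'd H (y + t *: u) u).
  rewrite !scale1r !scale0r !addr0; apply => t t01.
  exact: (is_deriveB (is_derive_line (dH _)) (is_derive_line (dH _))).
have [s s01 sE] : exists2 s : R, 0 <= s <= 1 &
    'd H (y + t *: u + w) u - 'd H (y + t *: u)
      u = diff2 H (y + t *: u + s *: w) u w.
  have := @MVT01 R (fun s => 'd H (y + t *: u + s *: w) u)
    (fun s => diff2 H (y + t *: u + s *: w) u w).
  by rewrite !scale1r !scale0r !addr0; apply => s s01; exact: is_derive_line.
exists (y + t *: u + s *: w).
  rewrite -(addrA y) [y + _]addrC addrK (le_trans (ler_normD _ _))// !normrZ.
  have /andP[t0 t1] := t01; have /andP[s0 s1] := s01.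
  by rewrite !ger0_norm// lerD// ler_piMl.
rewrite -sE [y + t *: u + w]addrAC -tE [y + u + w]addrAC.
by rewrite opprB addrA [RHS]addrAC.
Qed.

(** The second difference is symmetric in its two increments. For small increments it is a value of
    either mixed derivative at a point close to [y], and continuity transfers the equality to
    [y]. *)
Lemma diff2_sym (H : V -> R) (y u w : V) : Cn 2 H ->
  diff2 H y u w = diff2 H y w u.
Proof.
move=> C2H; have [dH C1] := C2H.
have d2H x v : differentiable (fun z => 'd H z v) x by case: (C1 v).
have cH v v' : continuous (fun x => diff2 H x v v') by case: (C1 v) =>
  _ /(_ v').
apply/eqP; rewrite -subr_eq0 -normr_le0; apply/ler_addgt0Pr => eps eps0;
  rewrite add0r.
have e20 : 0 < eps / 2 by rewrite divr_gt0.
have : \forall x \near y, `|diff2 H y u w - diff2 H x u w| <= eps / 2 /\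
    `|diff2 H y w u - diff2 H x w u| <= eps / 2.
  near=> x; split; near: x.
    exact: ((cvgrPdist_le _ _).1 (cH u w y) _ e20).
  exact: ((cvgrPdist_le _ _).1 (cH w u y) _ e20).
move=> /nbhs_normP[r /= r0 rP].
(* Scaling both increments by [s] keeps the intermediate points within [r] of [y]; the 1 covers the
   case where [u] and [w] vanish. The factor [s ^+ 2] cancels below by bilinearity. *)
pose s := r / (2 * (`|u| + `|w| + 1)).
have n1 : 0 < `|u| + `|w| + 1 by rewrite ltr_wpDl// addr_ge0.
have s0 : 0 < s by rewrite divr_gt0// mulr_gt0.
have sr : s * (`|u| + `|w|) < r.
  rewrite /s mulrAC ltr_pdivrMr ?mulr_gt0// ltr_pM2l//.
  have := normr_ge0 u; have := normr_ge0 w; lra.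
clearbody s.
have [x xy xE] := second_difference y (s *: u) (s *: w) C2H.
have [z zy zE] := second_difference y (s *: w) (s *: u) C2H.
have nb v : `|v - y| <= `|s *: u| + `|s *: w| -> `|y - v| < r.
  have sr' : `|s *: u| + `|s *: w| < r by rewrite !normrZ -mulrDr gtr0_norm.
  by rewrite distrC => /le_lt_trans; apply.
have d2Z v a b : diff2 H v (s *: a) (s *: b) = s ^+ 2 * diff2 H v a b.
  have [L LE] := linear_pack (diff2_linear_l (s *: b) (d2H v)).
  rewrite -[LHS]/((fun w => diff2 H v w (s *: b)) (s *: a)) LE linearZ -LE /=.
  by rewrite /diff2 linearZ /GRing.scale /= mulrA expr2.
have xz : diff2 H x u w = diff2 H z w u.
  apply: (@mulfI _ (s ^+ 2)); first by rewrite expf_neq0// gt_eqF.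
  rewrite -!d2Z -xE -zE [y + s *: w + s *: u]addrAC; congr (_ + _).
  by rewrite -!addrA; congr (_ + _); rewrite addrC.
have zy' : `|z - y| <= `|s *: u| + `|s *: w| by rewrite [leRHS]addrC.
have [_] := rP _ (nb _ zy'); have [+ _] := rP _ (nb _ xy); rewrite -xz.
move: (diff2 H y u w) (diff2 H y w u) (diff2 H x u w) => a b m.
by move=> h1 h2; rewrite (le_trans (ler_distD m _ _))//
  [`|m - b|]distrC [leRHS]splitr lerD.
Unshelve. all: by end_near. Qed.

End Schwarz.

(** * Stage equations *)

Section Proximity.
Context {R : realType} {V : normedModType R}.

Lemma near_prodP (y0 : V) (P : R * V -> Prop) :
  (\forall p \near ((0 : R), y0), P p) <->
  exists2 r : R, 0 < r & forall h y, `|h| < r -> `|y - y0| < r -> P (h, y).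
Proof.
split=> [/nbhs_ballP[r /= r0 rP]|[r r0 rP]].
  exists r => // h y hr yr; apply: rP; split => /=.
    by rewrite -ball_normE /= sub0r normrN.
  by rewrite -ball_normE /= distrC.
apply/nbhs_ballP; exists r => //= -[h y] [/= hr yr]; apply: rP.
  by move: hr; rewrite -ball_normE /= sub0r normrN.
by move: yr; rewrite -ball_normE /= distrC.
Qed.

End Proximity.

(** Banach's fixed point theorem is applied to matrices of stages and requires a complete normed
    space. *)
HB.instance Definition _ (R : realType) (m n : nat) :=
  Uniform_isComplete.Build 'M[R]_(m, n) cauchy_cvg.

(** The closed ball is mapped to itself: the centre moves by at most [r / 2], and contraction keeps
    images within [r / 2] of the image of the centre. *)
Lemma contraction_ball (R : realType) m n (psi : 'M[R]_(m, n) -> 'M[R]_(m, n))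
    (K0 : 'M[R]_(m, n)) (r : R) :
  0 <= r -> `|psi K0 - K0| <= r / 2 ->
  (forall K K', `|K - K0| <= r -> `|K' - K0| <= r ->
     `|psi K - psi K'| <= 2^-1 * `|K - K'|) ->
  exists2 K, `|K - K0| <= r & K = psi K.
Proof.
move=> r0 psi0 psiC.
pose U := [set K : 'M[R]_(m, n) | `|K - K0| <= r].
have UK0 : U K0 by rewrite /U /= subrr normr0.
have fU : set_fun U U psi.
  move=> K UK; rewrite /U /= -(subrK (psi K0) (psi K)) -addrA [r]splitr.
  rewrite (le_trans (ler_normD _ _))// lerD// (le_trans (psiC _ _ UK UK0))//.
  by rewrite mulrC ler_wpM2r ?invr_ge0.
have ctr : is_contraction (mkfun fU).
  exists (2^-1)%:nng; split => /=; first by rewrite invf_lt1 ?ltr1n.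
  by move=> [K K'] [/= UK UK']; exact: psiC.
have clU : closed U.
  rewrite (_ : U = closed_ball_ normr K0 r); first exact: closed_closed_ball_.
  by apply/seteqP; split => K; rewrite /U /closed_ball_ /= distrC.
have [K UK KE] := banach_fixed_point ctr clU (ex_intro _ K0 UK0).
by exists K.
Qed.

(* The coefficients may depend on the coordinate [l]: this covers at once a
   plain method and a partitioned one applied to the concatenated vector. *)
Section Stages.
Context {R : realType} {s d : nat}.
Variable al : 'I_d -> 'M[R]_s.

Definition stage (y : 'rV[R]_d) (h : R) (K : 'M[R]_(s, d)) (i : 'I_s) :
    'rV[R]_d :=
  \row_l (y 0 l + h * \sum_j al l i j * K j l).

(** The solutions of the stage equations are the fixed points of this map in [K]. *)
Definition stage_rhs (F : 'rV[R]_d -> 'rV[R]_d) h y (K : 'M[R]_(s, d)) :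
    'M[R]_(s, d) :=
  \matrix_i F (stage y h K i).

Lemma stage_linear a y h K y' K' i :
  stage (a *: y + y') h (a *: K + K') i = a *: stage y h K i + stage y' h K' i.
Proof.
apply/rowP => l; rewrite !mxE.
rewrite (eq_bigr (fun j => a * (al l i j * K j l) + al l i j * K' j l));
  last first.
  by move=> j _; rewrite !mxE; ring.
by rewrite big_split /= -mulr_sumr; ring.
Qed.

Lemma stageB y h K y' K' i :
  stage y h K i - stage y' h K' i = stage (y - y') h (K - K') i.
Proof.
have := stage_linear (-1) y' h K' y K i.
by rewrite !scaleN1r [- y' + _]addrC [- K' + _]addrC => ->; rewrite addrC.
Qed.

Lemma stage_shift y h K i : stage y h K i = y + stage 0 h K i.
Proof. by apply/rowP => l; rewrite !mxE add0r. Qed.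

Definition coef_bound : R := \sum_l \sum_i \sum_j `|al l i j|.

Lemma coef_bound_ge0 : 0 <= coef_bound.
Proof. by do 3! (apply: sumr_ge0 => ? _). Qed.

Lemma stage0_norm h K i : `|stage 0 h K i| <= `|h| * (coef_bound * `|K|).
Proof.
apply: mx_norm_le => [|a l];
  first by rewrite mulr_ge0// mulr_ge0// coef_bound_ge0.
rewrite !mxE add0r normrM ler_wpM2l// (le_trans (ler_norm_sum _ _ _))//.
rewrite (@le_trans _ _ (\sum_j `|al l i j| * `|K|))//.
  by apply: ler_sum => j _; rewrite normrM ler_wpM2l// mx_coord_le.
rewrite -mulr_suml ler_wpM2r//.
rewrite /coef_bound (bigD1 l)//= [X in _ <= X + _](bigD1 i)//= -addrA lerDl.
by rewrite addr_ge0//; repeat (apply: sumr_ge0 => ? _).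
Qed.

Variables (F : 'rV[R]_d -> 'rV[R]_d) (y0 : 'rV[R]_d).
Hypothesis F1 : Cn 1 F.

Let K0 : 'M[R]_(s, d) := \matrix_i F y0.

(** The radii are matched: [F] has Lipschitz constant [r^-1] on the ball of radius [r], and stage
    values vary with the stages by a factor of at most [r / 2], so that the composite contracts by
    1/2. *)
Lemma stage_region : exists r, exists2 rho, 0 < r /\ 0 < rho &
  [/\ forall x v, `|x - y0| < r -> `|'d F x v| <= r^-1 * `|v|,
      forall h y K i, `|h| < rho -> `|y - y0| < rho -> `|K - K0| <= 1 ->
        `|stage y h K i - y0| <= r / 2 &
      forall h K i, `|h| < rho -> `|stage 0 h K i| <= r / 2 * `|K|].
Proof.
have : \forall r \near (0 : R)^'+, 0 < r /\
    forall x v, `|x - y0| < r -> `|'d F x v| <= r^-1 * `|v|.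
  by near=> r; split; near: r; [exact: nbhs_right_gt|exact: C1_diff_bound].
move=> /filter_ex[r [r0 rP]].
have A0 := coef_bound_ge0; set A := coef_bound in A0 *.
(* In [B] the 1 accounts for the displacement of [y] and the other term for the stage increments,
   since [K] has norm at most [|K0| + 1]. *)
pose B := 1 + A * (`|K0| + 1).
have AK : 0 <= A * (`|K0| + 1) by rewrite mulr_ge0// addr_ge0.
have B0 : 0 < B by rewrite ltr_pwDl.
exists r, (r / 2 / B); first by split => //; rewrite !divr_gt0.
split => // [h y K i hr yr KK|h K i hr].
  rewrite stage_shift addrAC (le_trans (ler_normD _ _))//.
  have -> : r / 2 = r / 2 / B + r / 2 / B * (A * (`|K0| + 1)).
    by rewrite -[X in X + _]mulr1 -mulrDr -/B divfK// gt_eqF.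
  rewrite lerD ?(ltW yr)// (le_trans (stage0_norm _ _ _))//
    ler_pM ?mulr_ge0 ?(ltW hr)//.
  by rewrite ler_wpM2l// norm_le_dist// distrC.
rewrite (le_trans (stage0_norm _ _ _))// mulrA ler_wpM2r//.
rewrite (@le_trans _ _ (r / 2 / B * A))//; first by rewrite ler_wpM2r// ltW.
rewrite mulrAC ler_pdivrMr// ler_wpM2l// ?divr_ge0 ?(ltW r0)//.
by rewrite /B mulrDr mulr1 addrA ler_wpDl// ?addr_ge0// mulr_ge0.
Unshelve. all: by end_near. Qed.

Section Region.
Variables (r rho : R).
Hypothesis r0 : 0 < r.
Hypothesis dFr : forall x v, `|x - y0| < r -> `|'d F x v| <= r^-1 * `|v|.
Hypothesis str : forall h y K i, `|h| < rho -> `|y - y0| < rho ->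
  `|K - K0| <= 1 -> `|stage y h K i - y0| <= r / 2.
Hypothesis st0 : forall h K i, `|h| < rho -> `|stage 0 h K i| <= r / 2 * `|K|.

Let rV : 0 <= r^-1. Proof. by rewrite invr_ge0 ltW. Qed.

Let r2 : r / 2 < r.
Proof. by rewrite ltr_pdivrMr// mulr_natr mulr2n ltrDl. Qed.

Lemma stage_rhs_lipschitz h y K y' K' :
  `|h| < rho -> `|y - y0| < rho -> `|y' - y0| < rho ->
  `|K - K0| <= 1 -> `|K' - K0| <= 1 ->
  `|stage_rhs F h y K - stage_rhs F h y' K'| <=
    r^-1 * `|y - y'| + 2^-1 * `|K - K'|.
Proof.
move=> hr yr y'r KK KK'.
apply: mx_norm_rows => [|i]; first by rewrite addr_ge0// mulr_ge0.
rewrite raddfB /= !rowK.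
have s1 := le_lt_trans (str i hr yr KK) r2.
have s2 := le_lt_trans (str i hr y'r KK') r2.
rewrite (le_trans (diff_bound_lipschitz F1.1 rV dFr s1 s2))//.
rewrite stageB stage_shift.
rewrite (@le_trans _ _ (r^-1 * (`|y - y'| + r / 2 * `|K - K'|)))//.
  by rewrite ler_wpM2l// (le_trans (ler_normD _ _))// lerD2l st0.
by rewrite mulrDr lerD2l mulrA mulrA mulVf ?gt_eqF// mul1r.
Qed.

Lemma stage_rhs_dist h y K c :
  `|h| < rho -> `|y - y0| < rho -> `|K - K0| <= 1 -> 0 <= c ->
  (forall i, `|stage y h K i - y0| <= c) ->
    `|stage_rhs F h y K - K0| <= r^-1 * c.
Proof.
move=> hr yr KK c0 stc.
apply: mx_norm_rows => [|i]; first by rewrite mulr_ge0.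
rewrite raddfB /= !rowK.
have s1 := le_lt_trans (str i hr yr KK) r2.
have s2 : `|y0 - y0| < r by rewrite subrr normr0.
by rewrite (le_trans (diff_bound_lipschitz F1.1 rV dFr s1 s2))// ler_wpM2l.
Qed.

End Region.

(** A fixed point is chosen separately for each [(h, y)]. Continuity at [(0, y0)] then follows from
    a bound on the distance to [K0] that vanishes there. *)
Lemma stages_exist : exists2 k : R * 'rV[R]_d -> 'M[R]_(s, d),
  {for (0, y0), continuous k} &
  \forall p \near ((0 : R), y0), k p = stage_rhs F p.1 p.2 (k p).
Proof.
have [r [rho [r0 rho0] [dFr str st0]]] := stage_region.
have K00 : `|K0 - K0| <= 1 by rewrite subrr normr0.
have sol p : exists K, `|p.1| < rho -> `|p.2 - y0| < rho ->
    `|K - K0| <= 1 /\ K = stage_rhs F p.1 p.2 K.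
  (* Outside the region the choice is arbitrary, and 0 is taken. *)
  have [hr|] := ltP `|p.1| rho; last by exists 0.
  have [yr|] := ltP `|p.2 - y0| rho; last by exists 0.
  have [||K K' KK KK'|K KK KE] :=
    @contraction_ball _ _ _ (stage_rhs F p.1 p.2) K0 1.
  - by [].
  - rewrite (le_trans (stage_rhs_dist r0 dFr str hr yr K00 _ (fun i =>
    str _ _ _ i hr yr K00)))//.
      by rewrite divr_ge0 ?(ltW r0).
    by rewrite mulrA mulVf ?gt_eqF.
  - have := stage_rhs_lipschitz r0 dFr str st0 hr yr yr KK KK'.
    by rewrite subrr normr0 mulr0 add0r.
  - by exists K.
have [k kP] := choice sol; exists k; last first.
  apply/near_prodP; exists rho => // h y hr yr.
  by have [] := kP (h, y) hr yr.
have kd p : `|p.1| < rho -> `|p.2 - y0| < rho ->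
    `|k p - K0| <= r^-1 * (`|p.2 - y0| + `|p.1| * (coef_bound * (`|K0| + 1))).
  move=> hr yr; have [KK KE] := kP p hr yr.
  rewrite {1}KE; apply: (stage_rhs_dist r0 dFr str hr yr KK) => [|i].
    by rewrite addr_ge0// mulr_ge0// mulr_ge0 ?coef_bound_ge0// addr_ge0.
  rewrite stage_shift addrAC (le_trans (ler_normD _ _))// lerD2l.
  rewrite (le_trans (stage0_norm _ _ _))// ler_wpM2l//
    ler_wpM2l ?coef_bound_ge0//.
  by rewrite norm_le_dist// distrC.
have kK0 : k (0, y0) = K0.
  apply/eqP; rewrite -subr_eq0 -normr_le0 (le_trans (kd _ _ _))//= ?normr0
    ?subrr ?normr0//.
  by rewrite mul0r addr0 mulr0.
apply/cvgrPdist_le => e e0; rewrite kK0.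
apply/near_prodP.
pose C := r^-1 * (1 + coef_bound * (`|K0| + 1)).
have CB : 0 <= coef_bound * (`|K0| + 1)
  by rewrite mulr_ge0 ?coef_bound_ge0// addr_ge0.
have C0 : 0 < C by rewrite mulr_gt0 ?invr_gt0// ltr_pwDl.
exists (minr rho (e / C)) => [|h y]; first by rewrite lt_min rho0 divr_gt0.
rewrite !lt_min => /andP[hr he] /andP[yr ye].
rewrite distrC (le_trans (kd _ _ _))//=.
have -> : e = r^-1 * (e / C + e / C * (coef_bound * (`|K0| + 1))).
  rewrite -[X in X + _]mulr1 -mulrDr mulrCA -/C divfK// gt_eqF//.
by rewrite ler_wpM2l ?invr_ge0 ?(ltW r0)// lerD ?(ltW ye)// ler_wpM2r// ltW.
Qed.

End Stages.

(** * Expansions in powers of the step size *)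

Section PowerBounds.
Context {R : realType} {V : normedModType R}.

(** The neighbourhood includes [h = 0]: [isO 0] means bounded near 0, and a positive exponent forces
    [phi 0 = 0]. *)
Definition isO (n : nat) (phi : R -> V) : Prop :=
  exists2 C : R, 0 <= C & \forall h \near (0 : R), `|phi h| <= C * `|h| ^+ n.

Lemma isO_le n (C : R) (phi : R -> V) :
  (\forall h \near (0 : R), `|phi h| <= C * `|h| ^+ n) -> isO n phi.
Proof.
move=> phiC; exists `|C| => //; apply: filterS phiC => h /le_trans; apply.
by rewrite ler_wpM2r ?exprn_ge0// ler_norm.
Qed.

Lemma isO_near n (phi psi : R -> V) :
  (\forall h \near (0 : R), phi h = psi h) -> isO n phi -> isO n psi.
Proof. by move=> e [C C0 h]; exists C => //; apply: filterS2 e h => x ->. Qed.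

Lemma isO_eq n (phi psi : R -> V) : phi =1 psi -> isO n phi -> isO n psi.
Proof. by move=> e; apply: isO_near; near=> h. Unshelve. all: by end_near. Qed.

Lemma isOD n (phi psi : R -> V) :
  isO n phi -> isO n psi -> isO n (fun h => phi h + psi h).
Proof.
move=> [C C0 phiC] [D D0 psiD]; exists (C + D); first exact: addr_ge0.
apply: filterS2 phiC psiD => h p q.
by rewrite (le_trans (ler_normD _ _))// mulrDl lerD.
Qed.

Lemma isOZ n (a : R) (phi : R -> V) : isO n phi -> isO n (fun h => a *: phi h).
Proof.
move=> [C C0 phiC]; exists (`|a| * C); first exact: mulr_ge0.
by apply: filterS phiC => h p; rewrite normrZ -mulrA ler_wpM2l.
Qed.

Lemma isO_mulh n (phi : R -> V) : isO n phi -> isO n.+1 (fun h => h *: phi h).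
Proof.
move=> [C C0 phiC]; exists C => //.
by apply: filterS phiC => h p; rewrite normrZ exprS mulrCA ler_wpM2l.
Qed.

Lemma isO_weaken n m (phi : R -> V) : (m <= n)%N -> isO n phi -> isO m phi.
Proof.
move=> mn [C C0 phiC]; exists C => //.
have h1 : \forall h \near (0 : R), `|h| <= 1.
  by apply/nbhs_normP; exists 1 => //= h /=; rewrite sub0r normrN => /ltW.
apply: filterS2 h1 phiC => h h1 p; rewrite (le_trans p)// ler_wpM2l//.
by rewrite ler_wiXn2l.
Qed.

Lemma isO_cst (a : V) : isO 0 (fun=> a).
Proof. by apply: (@isO_le _ `|a|); near=> h;
  rewrite expr0 mulr1. Unshelve. all: by end_near. Qed.

Lemma isO_sum n (I : Type) (r : seq I) (phi : I -> R -> V) :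
  (forall i, isO n (phi i)) -> isO n (fun h => \sum_(i <- r) phi i h).
Proof.
move=> phiO; elim: r => [|i r IH].
  apply: (@isO_le _ 0); near=> h; rewrite big_nil normr0 mul0r//.
by apply: isO_eq (isOD (phiO i) IH) => h; rewrite big_cons.
Unshelve. all: by end_near. Qed.

Lemma isO_small (phi : R -> V) (P : V -> Prop) :
  isO 1 phi -> (\forall x \near (0 : V), P x) -> \forall h \near (0 : R),
    P (phi h).
Proof.
move=> [C C0 phiC] /nbhs_normP[r /= r0 rP].
have h1 : \forall h \near (0 : R), `|h| < r / (C + 1).
  apply/nbhs_normP; exists (r / (C + 1)) => /=;
    first by rewrite divr_gt0// ltr_wpDl.
  by move=> h /=; rewrite sub0r normrN.
apply: filterS2 h1 phiC => h h1 p; apply: rP => /=;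
  rewrite sub0r normrN (le_lt_trans p)//.
rewrite expr1; move: h1; rewrite ltr_pdivlMr ?ltr_wpDl// => /(le_lt_trans _);
  apply.
by rewrite mulrC ler_wpM2l// lerDl.
Qed.

End PowerBounds.

Lemma isO_mx (R : realType) m n k (phi : R -> 'M[R]_(m, n)) :
  (forall i, isO k (fun h => row i (phi h))) -> isO k phi.
Proof.
move=> phiO.
have /choice[C CP] : forall i, exists C : R, 0 <= C /\
    \forall h \near (0 : R), `|row i (phi h)| <= C * `|h| ^+ k.
  by move=> i; have [C C0 h] := phiO i; exists C.
exists (\sum_i C i); first by apply: sumr_ge0 => i _; have [] := CP i.
have /filter_forall : forall i, \forall h \near (0 : R),
  `|row i (phi h)| <= C i * `|h| ^+ k.
  by move=> i; have [] := CP i.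
apply: filterS => h hP; apply: mx_norm_rows => [|i].
  by rewrite mulr_ge0 ?exprn_ge0//; apply: sumr_ge0 => i _; have [] := CP i.
rewrite (le_trans (hP i))// ler_wpM2r ?exprn_ge0// (bigD1 i)//= lerDl.
by apply: sumr_ge0 => j _; have [] := CP j.
Qed.

Section Integration.
Context {R : realType} {d : nat}.

(** The mean value bound is applied on [[0, 1]] to [t |-> X (t * h)], whose derivative is
    [h *: G (t * h)]. This treats both signs of [h] at once. *)
Lemma isO_integral n (X G : R -> 'rV[R]_d) : X 0 = 0 ->
  (\forall t \near (0 : R), forall l,
     is_derive t (1 : R) (fun s => X s 0 l) (G t 0 l)) ->
  isO n G -> isO n.+1 X.
Proof.
move=> X0 dX [C C0 GC]; exists C => //.
have : \forall t \near (0 : R), (forall l,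
     is_derive t (1 : R) (fun s =>
       X s 0 l) (G t 0 l)) /\ `|G t| <= C * `|t| ^+ n.
  by apply: filterS2 dX GC => t.
move=> /nbhs_normP[r /= r0 rP]; apply/nbhs_normP; exists r => //= h /=.
rewrite sub0r normrN => hr.
have th t : 0 <= t <= 1 -> `|t * h| <= `|h|.
  by move=> /andP[t0 t1]; rewrite normrM ger0_norm// ler_piMl.
have thr t : 0 <= t <= 1 -> `|0 - t * h| < r.
  by move=> t01; rewrite sub0r normrN (le_lt_trans (th _ t01)).
have -> : X h = X (1 * h) - X (0 * h) by rewrite mul1r mul0r X0 subr0.
apply: (@mx_mean_value _ _ _ (fun t => X (t * h)) (fun t => h *: G (t * h))).
- by rewrite mulr_ge0// exprn_ge0.
- move=> t i l t01; have [dXt _] := rP _ (thr _ t01); rewrite ord1.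
  have dm : is_derive t (1 : R) (fun s => s * h) h.
    by apply: is_derive_eq; rewrite scaler0 add0r /GRing.scale /= mulr1.
  rewrite mxE mulrC.
  exact: (@is_derive1_comp R (fun s => X s 0 l) (fun s =>
    s * h) t _ _ (dXt l) dm).
- move=> t t01; have [_ Gt] := rP _ (thr _ t01).
  rewrite normrZ exprS mulrCA ler_wpM2l// (le_trans Gt)// ler_wpM2l//.
  by rewrite lerXn2r ?nnegrE// th.
Qed.

Lemma isO_integral_poly n (X G : R -> 'rV[R]_d) a b c : X 0 = 0 ->
  (\forall t \near (0 : R), forall l,
     is_derive t (1 : R) (fun s => X s 0 l) (G t 0 l)) ->
  isO n (fun t => G t - (a + (2 * t) *: b + (3 * t ^+ 2) *: c)) ->
  isO n.+1 (fun t => X t - (t *: a + t ^+ 2 *: b + t ^+ 3 *: c)).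
Proof.
move=> X0 dX; apply: isO_integral.
  by rewrite X0 !expr0n /= !scale0r !addr0 subr0.
apply: filterS dX => t dX l.
rewrite (_ : (fun s => _) = (fun s => X s 0 l) \-
    ((fun s => s * a 0 l) \+ (fun s => s ^+ 2 * b 0 l) \+ (fun s =>
      s ^+ 3 * c 0 l))).
  apply: is_derive_eq; rewrite !mxE; congr (_ - (_ + _ + _));
  by rewrite scaler0 add0r /GRing.scale /=; ring.
by apply/funext => s; rewrite !mxE.
Qed.

End Integration.

(** * Taylor expansion of the exact flow *)

Section Jets.
Context {R : realType} {d : nat}.
Implicit Types (X : R -> 'rV[R]_d) (u v w : 'rV[R]_d).

(** [L] and [Q] stand for the first and second differentials of [F] at [y0]. The expansions below
    rely only on their linearity, their bounds and the cubic remainder. *)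
Record taylor2 (F : 'rV[R]_d -> 'rV[R]_d) (y0 : 'rV[R]_d)
    (L : {linear 'rV[R]_d -> 'rV[R]_d}) (Q : 'rV[R]_d -> 'rV[R]_d ->
      'rV[R]_d) : Prop := {
  taylor2_linear_l : forall v, linear (Q^~ v);
  taylor2_linear_r : forall u, linear (Q u);
  taylor2_L : exists2 c : R, 0 <= c & forall u, `|L u| <= c * `|u|;
  taylor2_Q : exists2 c : R, 0 <= c & forall u v, `|Q u v| <= c * `|u| * `|v|;
  taylor2_remainder : exists2 c : R, 0 <= c & \forall x \near (0 : 'rV[R]_d),
    `|F (y0 + x) - F y0 - (L x + 2^-1 *: Q x x)| <= c * `|x| ^+ 3 }.

Lemma C3_taylor2 (F : 'rV[R]_d -> 'rV[R]_d) y0 : Cn 3 F ->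
  exists L Q, taylor2 F y0 L Q.
Proof.
move=> F3; exists ('d F y0), (diff2 F y0).
have d2F u : differentiable (fun z => 'd F z u) y0 by case: F3 => _ /(_ u)[].
split.
- by move=> v; exact: diff2_linear_l.
- by move=> u a v w; exact: (linearP ('d (fun z => 'd F z u) y0) a v w).
- exists (\sum_j `|'d F y0 (delta_mx 0 j)|); first by apply: sumr_ge0.
  move=> u; rewrite linear_delta (le_trans (ler_norm_sum _ _ _))// mulr_suml.
  by apply: ler_sum => j _; rewrite normrZ mulrC ler_wpM2l// mx_coord_le.
- exists (\sum_i \sum_j `|diff2 F y0 (delta_mx 0 i) (delta_mx 0 j)|).
    by do 2! (apply: sumr_ge0 => ? _).
  move=> u v; rewrite diff2_delta// (le_trans (ler_norm_sum _ _ _))//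
    !mulr_suml.
  apply: ler_sum => i _; rewrite normrZ mulrAC [leRHS]mulrC.
  apply: ler_pM => //; first exact: mx_coord_le.
  rewrite (le_trans (ler_norm_sum _ _ _))// mulr_suml.
  by apply: ler_sum => j _; rewrite normrZ mulrC ler_wpM2l// mx_coord_le.
- exact: C3_taylor.
Qed.

Variables (F : 'rV[R]_d -> 'rV[R]_d) (y0 : 'rV[R]_d).
Variables (L : {linear 'rV[R]_d -> 'rV[R]_d}) (Q : 'rV[R]_d -> 'rV[R]_d ->
  'rV[R]_d).
Hypothesis FT : taylor2 F y0 L Q.

Lemma isO_L n X : isO n X -> isO n (fun h => L (X h)).
Proof.
have [c c0 cP] := taylor2_L FT.
move=> [C C0 XC]; exists (c * C); first exact: mulr_ge0.
by apply: filterS XC => h p; rewrite (le_trans (cP _))// -mulrA ler_wpM2l.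
Qed.

Lemma isO_Q n m X Y : isO n X -> isO m Y ->
  isO (n + m) (fun h => Q (X h) (Y h)).
Proof.
have [c c0 cP] := taylor2_Q FT.
move=> [C C0 XC] [D D0 YD]; exists (c * C * D); first by rewrite !mulr_ge0.
apply: filterS2 XC YD => h p q; rewrite (le_trans (cP _ _))//.
rewrite exprD -!mulrA ler_wpM2l//
  [leRHS](_ : _ = C * `|h| ^+ n * (D * `|h| ^+ m)).
  by rewrite ler_pM.
by ring.
Qed.

Lemma isO_remainder X : isO 1 X ->
  isO 3 (fun h => F (y0 + X h) - F y0 - (L (X h) + 2^-1 *: Q (X h) (X h))).
Proof.
move=> XO; have [c c0 cP] := taylor2_remainder FT.
have h1 := isO_small XO cP; have [C C0 XC] := XO.
exists (c * C ^+ 3); first by rewrite mulr_ge0 ?exprn_ge0.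
apply: filterS2 h1 XC => h h1 p; rewrite (le_trans h1)// -mulrA ler_wpM2l//.
by rewrite -exprMn lerXn2r ?nnegrE// ?mulr_ge0// -[`|h|]expr1.
Qed.

Lemma jet0 X : isO 1 X -> isO 1 (fun h => F (y0 + X h) - F y0).
Proof.
move=> XO.
have h1 := isO_weaken (isT : (1 <= 3)%N) (isO_remainder XO).
have h2 := isO_weaken (isT : (1 <= 2)%N) (isOZ 2^-1 (isO_Q XO XO)).
by apply: isO_eq (isOD h1 (isOD (isO_L XO) h2)) => h; rewrite subrK.
Qed.

Lemma jet1 X u : isO 2 (fun h => X h - h *: u) ->
  isO 2 (fun h => F (y0 + X h) - (F y0 + h *: L u)).
Proof.
move=> XO2.
have XO : isO 1 X.
  apply: isO_eq (isOD (isO_weaken (isT : (1 <= 2)%N) XO2)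
    (isO_mulh (isO_cst u))) => h.
  by rewrite subrK.
have h1 := isO_weaken (isT : (2 <= 3)%N) (isO_remainder XO).
apply: isO_eq (isOD h1 (isOD (isO_L XO2) (isOZ 2^-1 (isO_Q XO XO)))) => h.
by rewrite linearB linearZ /=; apply/rowP => l; rewrite !mxE; ring.
Qed.

(** With [X h = h *: u + e h] and [e] of order [h ^+ 2], bilinearity leaves [h ^+ 2 *: Q u u] from
    the quadratic term; the mixed terms have order 3 and [Q (e h) (e h)] has order 4. *)
Lemma jet2 X u w : isO 3 (fun h => X h - (h *: u + h ^+ 2 *: w)) ->
  isO 3 (fun h => F (y0 + X h) -
    (F y0 + h *: L u + h ^+ 2 *: (L w + 2^-1 *: Q u u))).
Proof.
move=> XO3; pose e h := X h - h *: u.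
have hw : isO 2 (fun h => h ^+ 2 *: w).
  by apply: isO_eq (isO_mulh (isO_mulh (isO_cst w))) => h; rewrite scalerA.
have eO : isO 2 e.
  apply: isO_eq (isOD (isO_weaken (isT : (2 <= 3)%N) XO3) hw) => h.
  by rewrite /e opprD addrA subrK.
have XO : isO 1 X.
  apply: isO_eq (isOD (isO_weaken (isT : (1 <= 2)%N) eO)
    (isO_mulh (isO_cst u))) => h.
  by rewrite /e subrK.
have h1 := isO_remainder XO.
have h2 := isOD (isO_mulh (isO_Q (isO_cst u) eO))
  (isO_mulh (isO_Q eO (isO_cst u))).
have h3 := isO_weaken (isT : (3 <= 4)%N) (isO_Q eO eO).
apply: isO_eq (isOD h1 (isOD (isO_L XO3) (isOZ 2^-1 (isOD h2 h3)))) => h.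
have QX : Q (X h) (X h) = h ^+ 2 *: Q u u + (h *: Q u (e h) + h *: Q (e h)
  u + Q (e h) (e h)).
  have -> : X h = h *: u + e h by rewrite /e addrC subrK.
  rewrite (taylor2_linear_l FT) !(taylor2_linear_r FT).
  by apply/rowP => l; rewrite !mxE; ring.
have -> : L (X h - (h *: u + h ^+ 2 *: w)) = L (X h)
  - (h *: L u + h ^+ 2 *: L w).
  by rewrite linearB; congr (_ - _); rewrite linearD; congr (_ + _);
    exact: linearZ.
rewrite QX.
by apply/rowP => l; rewrite !mxE; ring.
Qed.

Let f0 := F y0.
Let f1 := L f0.
Let f2 := L f1.

(** The third order Taylor polynomial of the flow increment, written in the elementary differentials
    [f], [f' f], [f' f' f] and [f'' (f, f)]. *)
Definition flow_jet (h : R) : 'rV[R]_d :=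
  h *: f0 + h ^+ 2 *: (2^-1 *: f1) + h ^+ 3 *: (6^-1 *: (f2 + Q f0 f0)).

Lemma exact_expansion (Y : R -> 'rV[R]_d) : Y 0 = y0 -> {for y0,
  continuous F} ->
  (\forall t \near (0 : R), forall l,
     is_derive t (1 : R) (fun s => Y s 0 l) (F (Y t) 0 l)) ->
  isO 4 (fun h => Y h - y0 - flow_jet h).
Proof.
move=> Y0 cF dY.
pose X t := Y t - y0.
have YX t : Y t = y0 + X t by rewrite /X addrC subrK.
have X0 : X 0 = 0 by rewrite /X Y0 subrr.
have dX : \forall t \near (0 : R), forall l,
    is_derive t (1 : R) (fun s => X s 0 l) (F (y0 + X t) 0 l).
  apply: filterS dY => t dY l; rewrite -YX.
  rewrite (_ : (fun s => _) = (fun s => Y s 0 l) \- cst (y0 0 l)).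
    by apply: is_derive_eq; rewrite subr0.
  by apply/funext => s; rewrite !mxE.
(* Continuity of the solution makes [F (Y t)] bounded near 0, which starts the bootstrapping; each
   later integration gains one order. *)
have cY : {for 0, continuous Y}.
  apply/cvgrPdist_le => e e0.
  have /filter_forall : forall l, \forall t \near (0 : R),
    `|Y 0 0 l - Y t 0 l| <= e.
    move=> l; have [dl _] := nbhs_singleton dY l.
    have := differentiable_continuous ((derivable1_diffP _ _).1 dl).
    by move=> /cvgrPdist_le; apply.
  apply: filterS => t tP; apply: mx_norm_le => [|i l]; first exact: ltW.
  by rewrite ord1 !mxE.
have FO : isO 0 (fun t => F (y0 + X t)).
  apply: (@isO_le _ _ _ (`|F y0| + 1)).
  have cFY : {for 0, continuous (F \o Y)} by apply: continuous_comp => //;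
    rewrite Y0.
  apply: filterS ((cvgrPdist_le _ _).1 cFY 1 ltr01) => t.
  by rewrite /= Y0 expr0 mulr1 -YX; exact: norm_le_dist.
have XO1 := isO_integral X0 dX FO.
have XO2 : isO 2 (fun t => X t - t *: f0).
  apply: isO_eq (@isO_integral_poly _ _ _ X _ f0 0 0 X0 dX (isO_eq _ (jet0
    XO1))) => h;
  by rewrite !scaler0 !addr0.
have XO3 : isO 3 (fun t => X t - (t *: f0 + t ^+ 2 *: (2^-1 *: f1))).
  apply: isO_eq (@isO_integral_poly _ _ _ X _ f0 (2^-1 *: f1)
    0 X0 dX (isO_eq _ (jet1 XO2))) => h.
    by rewrite scaler0 addr0.
  by rewrite scaler0 addr0 scalerA mulrAC divff// mul1r.
apply: (@isO_integral_poly _ _ _ X _ f0 (2^-1 *: f1) (6^-1 *: (f2 + Q f0 f0))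
  X0 dX).
(* The cubic coefficient matches because [3 / 6 = 1 / 2] is the common factor of [f2] and [Q f0 f0]
   in the jet of [F]. *)
apply: isO_eq (jet2 XO3) => h.
by rewrite linearZ /=; apply/rowP => l; rewrite !mxE; field.
Qed.

End Jets.

(** * Taylor expansion of the numerical step *)

Section Numerical.
Context {R : realType} {s d : nat}.
Variables (al : 'I_d -> 'M[R]_s) (b c : 'I_s -> R).
(** The nodes [c] and the weights [b] are common to all coordinates. The order conditions are
    therefore the four classical ones up to order three, the last one being imposed for every
    coordinate. *)
Hypothesis alc : forall l i, \sum_j al l i j = c i.
Hypothesis b1 : \sum_i b i = 1.
Hypothesis bc : \sum_i b i * c i = 2^-1.
Hypothesis bcc : \sum_i b i * c i ^+ 2 = 3^-1.
Hypothesis bac : forall l, \sum_i b i * \sum_j al l i j * c j = 6^-1.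
Variables (F : 'rV[R]_d -> 'rV[R]_d) (y0 : 'rV[R]_d).
Variables (L : {linear 'rV[R]_d -> 'rV[R]_d}) (Q : 'rV[R]_d -> 'rV[R]_d ->
  'rV[R]_d).
Hypothesis FT : taylor2 F y0 L Q.

Lemma stage_isO n (K K' : R -> 'M[R]_(s, d)) i : isO n (fun h => K h - K' h) ->
  isO n.+1 (fun h => stage al 0 h (K h) i - stage al 0 h (K' h) i).
Proof.
move=> [C C0 KC]; exists (coef_bound al * C);
  first by rewrite mulr_ge0// coef_bound_ge0.
apply: filterS KC => h p;
  rewrite stageB subrr (le_trans (stage0_norm _ _ _ _))//.
rewrite [leRHS](_ : _ = `|h| * (coef_bound al * (C * `|h| ^+ n))); last first.
  by rewrite exprS; ring.
by rewrite !ler_wpM2l ?coef_bound_ge0.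
Qed.

Lemma numerical_expansion (K : R -> 'M[R]_(s, d)) : isO 0 K ->
  (\forall h \near (0 : R), K h = stage_rhs al F h y0 (K h)) ->
  isO 4 (fun h => h *: \sum_i b i *: row i (K h) - flow_jet F y0 L Q h).
Proof.
move=> K0 KE; pose X i h := stage al 0 h (K h) i.
set f0 := F y0; set f1 := L f0; set f2 := L f1.
have rowK n (M : R -> 'M[R]_(s, d)) :
    (forall i, isO n (fun h => F (y0 + X i h) - row i (M h))) ->
      isO n (fun h => K h - M h).
  move=> h; apply: isO_mx => i; apply: isO_near (h i).
  apply: filterS KE => t KE; rewrite raddfB /=; congr (_ - _).
  by rewrite [in RHS]KE matrix.rowK stage_shift.
have stage0 h i : stage al 0 h 0 i = 0.
  apply/rowP => l; rewrite !mxE big1 ?mulr0 ?addr0// => j _;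
    by rewrite mxE mulr0.
have X1 i : isO 1 (X i).
  apply: isO_eq (@stage_isO _ K (fun=> 0) i _) => [h|];
    first by rewrite stage0 subr0.
  by apply: isO_eq K0 => h; rewrite subr0.
have X2 i : isO 2 (fun h => X i h - h *: (c i *: f0)).
  apply: isO_eq (@stage_isO _ K (fun=> \matrix_j f0) i _) => [h|].
    congr (_ - _); apply/rowP => l; rewrite !mxE add0r.
    under eq_bigr do rewrite mxE; by rewrite -mulr_suml alc.
  by apply: rowK => j; apply: isO_eq (jet0 FT (X1 j)) => h; rewrite rowK.
(* The factor of [f1] depends on the coordinate, so [w i] need not be a multiple of [f1] and
   [L (w i)] cannot be simplified stage by stage. Only the weighted sum [bw] is such a multiple. *)
pose w i : 'rV[R]_d := \row_l ((\sum_j al l i j * c j) * f1 0 l).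
have X3 i : isO 3 (fun h => X i h - (h *: (c i *: f0) + h ^+ 2 *: w i)).
  apply: isO_eq (@stage_isO _ K (fun h =>
    \matrix_j (f0 + h *: (c j *: f1))) i _) => [h|].
    congr (_ - _); apply/rowP => l; rewrite !mxE add0r.
    rewrite (eq_bigr (fun j =>
      al l i j * f0 0 l + h * (al l i j * c j * f1 0 l))).
      by rewrite big_split /= -mulr_suml alc -mulr_sumr -mulr_suml; ring.
    by move=> j _; rewrite !mxE; ring.
  by apply: rowK => j; apply: isO_eq (jet1 FT (X2 j)) => h;
    rewrite rowK linearZ.
pose g i h := f0 + h *: (c i *: f1) + h ^+ 2 *: (L (w i) + (2^-1 * c i ^+ 2)
  *: Q f0 f0).
have X4 i : isO 3 (fun h => F (y0 + X i h) - g i h).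
  apply: isO_eq (jet2 FT (X3 i)) => h; congr (_ - _).
  have [qL qE] := linear_pack (taylor2_linear_l FT (c i *: f0)).
  have [rL rE] := linear_pack (taylor2_linear_r FT f0).
  have -> : Q (c i *: f0) (c i *: f0) = c i ^+ 2 *: Q f0 f0.
    rewrite -[LHS]/((Q^~ (c i *: f0)) (c i *: f0)) qE linearZ -qE /=.
    by rewrite rE linearZ scalerA expr2.
  have -> : L (c i *: f0) = c i *: f1 by exact: linearZ.
  by rewrite /g (scalerA 2^-1).
have bw : \sum_i b i *: w i = 6^-1 *: f1.
  apply/rowP => l; rewrite summxE mxE -(bac l) mulr_suml.
  by apply: eq_bigr => i _; rewrite !mxE mulrA.
have gE h : h *: \sum_i b i *: g i h = flow_jet F y0 L Q h.
  have -> : \sum_i b i *: g i h = f0 + h *: (2^-1 *: f1) +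
      h ^+ 2 *: (L (\sum_i b i *: w i) + (2^-1 * 3^-1) *: Q f0 f0).
    rewrite -{1}bc -bcc linear_sum -{1}[f0]scale1r -{1}b1.
    rewrite mulr_sumr !scaler_suml scaler_sumr -!big_split /= scaler_sumr
      -big_split /=.
    apply: eq_bigr => i _.
    have -> : L (b i *: w i) = b i *: L (w i) by exact: linearZ.
    by apply/rowP => l; rewrite !mxE; ring.
  have L6 : L (6^-1 *: f1) = 6^-1 *: f2 by exact: linearZ.
  rewrite bw L6 /flow_jet -/f0 -/f1 -/f2.
  by apply/rowP => l; rewrite !mxE; field.
have : isO 4 (fun h => h *: \sum_i b i *: (F (y0 + X i h) - g i h)).
  by apply: isO_mulh; apply: isO_sum => i; apply: isOZ.
apply: isO_near; apply: filterS KE => h KE; rewrite -gE -scalerBr -sumrB.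
congr (_ *: _); apply: eq_bigr => i _; rewrite scalerBr; congr (_ *: _ - _).
by rewrite [in RHS]KE matrix.rowK stage_shift.
Qed.

End Numerical.

(** * Partitioned methods *)

Section CnComposition.
Context {R : realType}.

(** The differential in direction [u] is [y |-> 'd g y (l u)] composed with [l], again of the same
    form, so induction on [N] applies. *)
Lemma Cn_comp_linear_r (U V W : normedModType R) N (l : {linear U ->
  V}) (g : V -> W) :
  continuous l -> Cn N g -> Cn N (g \o l).
Proof.
move=> lc; elim: N g => [|N IH] g /=.
  by move=> gc x; apply: continuous_comp; [exact: lc|exact: gc].
move=> [dg Cg].
have dl x : differentiable l x by exact: linear_differentiable.
split=> [x|u]; first exact: differentiable_comp.
rewrite (_ : (fun x => _) = (fun y => 'd g y (l u)) \o l); first exact: IH.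
apply/funext => x; have h := diff_comp (dl x) (dg (l x)).
by rewrite (congr1 (fun f => f u) h) /= (congr1 (fun f => f u) (diff_lin x lc)).
Qed.

Lemma Cn_comp_linear_l (U V W : normedModType R) N (l : {linear V ->
  W}) (g : U -> V) :
  continuous l -> Cn N g -> Cn N (l \o g).
Proof.
move=> lc; elim: N g => [|N IH] g /=.
  by move=> gc x; apply: continuous_comp; [exact: gc|exact: lc].
move=> [dg Cg].
have dl x : differentiable l x by exact: linear_differentiable.
split=> [x|u]; first exact: differentiable_comp.
rewrite (_ : (fun x => _) = l \o (fun y => 'd g y u)); first exact: IH.
apply/funext => x; have h := diff_comp (dg x) (dl (g x)).
rewrite (congr1 (fun f => f u) h) /=.
by rewrite (congr1 (fun f => f ('d g x u)) (diff_lin (g x) lc)).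
Qed.

Lemma CnD (V W : normedModType R) N (f g : V -> W) :
  Cn N f -> Cn N g -> Cn N (f + g).
Proof.
elim: N f g => [|N IH] f g /=.
  by move=> fc gc x; apply: cvgD; [exact: fc|exact: gc].
move=> [df Cf] [dg Cg]; split=> [x|u]; first exact: differentiableD.
rewrite (_ : (fun x => _) = (fun x => 'd f x u) + (fun x => 'd g x u));
  first exact: IH.
by apply/funext => x; rewrite (congr1 (fun h => h u) (diffD (df x) (dg x))).
Qed.

Lemma Cn_continuous (V W : normedModType R) N (f : V -> W) : Cn N f ->
  continuous f.
Proof. by case: N => // N [df _] x; exact: differentiable_continuous. Qed.

Lemma Cn_le (V W : normedModType R) N M (f : V -> W) : (M <= N)%N ->
  Cn N f -> Cn M f.
Proof.
elim: N M f => [|N IH] [|M] f //.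
  by move=> _; exact: Cn_continuous.
by move=> MN [df Cf]; split=> // u; exact: IH (Cf u).
Qed.

End CnComposition.

Section Concatenation.
Context {R : realType} {m n : nat}.
Local Notation V := 'rV[R]_m.
Local Notation W := 'rV[R]_n.

Definition join (p : V * W) : 'rV[R]_(m + n) := row_mx p.1 p.2.
Definition unjoin (x : 'rV[R]_(m + n)) : V * W := (lsubmx x, rsubmx x).

Lemma joinK : cancel join unjoin.
Proof. by move=> [a b]; rewrite /join /unjoin row_mxKl row_mxKr. Qed.

Lemma unjoinK : cancel unjoin join.
Proof. by move=> x; rewrite /join /unjoin hsubmxK. Qed.

Lemma joinB p q : join p - join q = join (p - q).
Proof. by rewrite /join opp_row_mx add_row_mx. Qed.

(** Both norms are maxima over the same entries. Neighbourhoods and error bounds thus pass unchanged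
    between pairs and concatenated vectors. *)
Lemma norm_join p : `|join p| = `|p|.
Proof.
rewrite [RHS]prod_normE; apply/le_anti/andP; split.
  apply: mx_norm_le => [|i l]; first by rewrite le_max normr_ge0.
  rewrite ord1 le_max; case: (split_ordP l) => j ->.
    by rewrite row_mxEl mx_coord_le.
  by rewrite row_mxEr mx_coord_le orbT.
rewrite ge_max; apply/andP; split; apply: mx_norm_le => // i j.
  by have := mx_coord_le (join p) i (lshift n j); rewrite row_mxEl.
by have := mx_coord_le (join p) i (rshift m j); rewrite row_mxEr.
Qed.

Lemma near_join (y0 : V * W) (P : R * 'rV[R]_(m + n) -> Prop) :
  (\forall p \near ((0 : R), join y0), P p) ->
  \forall p \near ((0 : R), y0), P (p.1, join p.2).
Proof.
move=> /near_prodP[r r0 rP]; apply/near_prodP; exists r => // h y hr yr.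
by apply: rP => //; rewrite joinB norm_join.
Qed.

Definition join_fun (g : V * W -> V) (f : V * W -> W) (x : 'rV[R]_(m + n)) :
  'rV[R]_(m + n) := join (g (unjoin x), f (unjoin x)).

(** The joint field is a sum of two terms, each a component of the system composed with linear maps
    on both sides. *)
Lemma join_fun_Cn N g f : Cn N g -> Cn N f -> Cn N (join_fun g f).
Proof.
move=> gN fN.
have lu : linear unjoin.
  by move=> a x y; rewrite /unjoin !linearP.
have [u uE] := linear_pack lu.
have lgl : linear (fun a : V => join (a, 0)).
  by move=> a x y; rewrite /join /= scale_row_mx add_row_mx scaler0 addr0.
have lfl : linear (fun b : W => join (0, b)).
  by move=> a x y; rewrite /join /= scale_row_mx add_row_mx scaler0 addr0.
have [lg lgE] := linear_pack lgl.
have [lf lfE] := linear_pack lfl.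
pose A : 'rV[R]_(m + n) -> 'rV[R]_(m + n) := lg \o (g \o u).
pose B : 'rV[R]_(m + n) -> 'rV[R]_(m + n) := lf \o (f \o u).
have -> : join_fun g f = A + B.
  apply/funext => x; rewrite -[RHS]/(A x + B x) /A /B /= -lgE -lfE -uE.
  by rewrite /join_fun /join add_row_mx addr0 add0r.
apply: CnD; apply: Cn_comp_linear_l; try exact: linear_rV_continuous.
  by apply: Cn_comp_linear_r => //; exact: linear_rV_continuous.
by apply: Cn_comp_linear_r => //; exact: linear_rV_continuous.
Qed.

End Concatenation.

Section Partitioned.
Context {R : realType} {s m n : nat}.
Variables (a a' : 'M[R]_s) (b : 'rV[R]_s).
Local Notation V := 'rV[R]_m.
Local Notation W := 'rV[R]_n.

(** Putting zeros on and above the diagonal turns the restricted sums of the explicit method into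
    full sums. *)
Definition strict_lower : 'M[R]_s := \matrix_(i,
  j) (if (j < i)%N then a' i j else 0).

Definition joint_coef (l : 'I_(m + n)) : 'M[R]_s :=
  if (l < m)%N then a else strict_lower.

Variables (g : V * W -> V) (f : V * W -> W).

Definition join_stages (k : 'I_s -> V) (k' : 'I_s -> W) : 'M[R]_(s, m + n) :=
  \matrix_i join (k i, k' i).

Lemma unjoin_stage y h k k' i :
  unjoin (stage joint_coef (join y) h (join_stages k k') i) =
  (y.1 + h *: \sum_(j < s) a i j *: k j,
   y.2 + h *: \sum_(j < s | (j < i)%N) a' i j *: k' j).
Proof.
congr (_, _); apply/rowP => l; rewrite !mxE.
  rewrite (unsplitK (inl l)) /joint_coef /= ltn_ord summxE.
  congr (_ + _ * _); apply: eq_bigr => j _; rewrite !mxE.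
  by rewrite (unsplitK (inl l)).
rewrite (unsplitK (inr l)) /joint_coef /= ltnNge leq_addr /= summxE.
congr (_ + _ * _); rewrite [RHS]big_mkcond /=; apply: eq_bigr => j _;
  rewrite !mxE.
by rewrite (unsplitK (inr l)); case: ifP; rewrite ?mul0r.
Qed.

Lemma prk_stepE h y k k' y1 :
  prk_step a b a' b g f h y k k' y1 <->
  join_stages k k' = stage_rhs joint_coef (join_fun g f) h (join y)
    (join_stages k k') /\
  join y1 = join y + h *: \sum_i b 0 i *: row i (join_stages k k').
Proof.
have jE : join (y.1 + h *: \sum_(i < s) b 0 i *: k i,
      y.2 + h *: \sum_(i < s) b 0 i *: k' i) =
    join y + h *: \sum_i b 0 i *: row i (join_stages k k').
  apply/rowP => l; case: (split_ordP l) => j ->; rewrite !mxE.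
    rewrite (unsplitK (inl j)) /= !mxE !summxE; congr (_ + _ * _).
    by apply: eq_bigr => i _; rewrite !mxE (unsplitK (inl j)).
  rewrite (unsplitK (inr j)) /= !mxE !summxE; congr (_ + _ * _).
  by apply: eq_bigr => i _; rewrite !mxE (unsplitK (inr j)).
have rE i : join (k i,
  k' i) = join_fun g f (stage joint_coef (join y) h (join_stages k k') i)
    <-> k i = g (unjoin (stage joint_coef (join y) h (join_stages k k') i)) /\
        k' i = f (unjoin (stage joint_coef (join y) h (join_stages k k') i)).
  split=> [/(can_inj joinK)[]//|[e1 e2]]; by rewrite /join_fun -e1 -e2.
split=> [[kE k'E ->]|[KE yE]].
  split; last by rewrite jE.
  apply/row_matrixP => i; rewrite !rowK; apply/rE.
  by rewrite unjoin_stage -kE -k'E.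
have KEi i := (rE i).1 (eq_trans (esym (rowK _ i)) (eq_trans (congr1 (row i)
  KE) (rowK _ i))).
split=> [i|i|].
- by have [+ _] := KEi i; rewrite unjoin_stage.
- by have [_] := KEi i; rewrite unjoin_stage.
- by apply: (can_inj joinK); rewrite yE jE.
Qed.

Lemma prk_map_exist y0 : Cn 1 g -> Cn 1 f -> exists Phi,
  prk_map a b a' b g f y0 Phi.
Proof.
move=> g1 f1; have F1 := join_fun_Cn g1 f1.
have [k kc kE] := stages_exist joint_coef (join y0) F1.
pose kj i (p : R * (V * W)) := unjoin (row i (k (p.1, join p.2))).
have kjc i : forall e, 0 < e -> \forall p \near ((0 : R), y0),
    `|kj i (0, y0) - kj i p| <= e.
  move=> e e0.
  have ke : \forall p \near ((0 : R), join y0), `|k (0, join y0) - k p| <= e.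
    exact: (cvgrPdist_le _ _).1 kc e e0.
  apply: filterS (near_join ke) => p; apply: le_trans.
  rewrite -norm_join -joinB !unjoinK -raddfB; exact: row_norm_le.
exists (fun h y => unjoin (join y + h *: \sum_i b 0 i *: row i (k (h,
  join y)))).
exists (fun i p => (kj i p).1), (fun i p => (kj i p).2); split.
- move=> i; apply/cvgrPdist_le => e e0; apply: filterS (kjc i e e0) => p.
  by apply: le_trans; rewrite [leRHS]prod_normE le_max lexx.
- move=> i; apply/cvgrPdist_le => e e0; apply: filterS (kjc i e e0) => p.
  by apply: le_trans; rewrite [leRHS]prod_normE le_max lexx orbT.
apply: filterS (near_join kE) => p /= KE; apply/prk_stepE.
have -> : join_stages (fun i => (kj i p).1) (fun i => (kj i p).2) = k (p.1,
  join p.2).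
  by apply/row_matrixP => i; rewrite rowK -surjective_pairing unjoinK.
by rewrite unjoinK.
Qed.

End Partitioned.

Lemma is_derive_coord (R : realType) (d : nat) (z : R -> 'rV[R]_d) t dz l :
  is_derive t (1 : R) z dz -> is_derive t (1 : R) (fun s => z s 0 l) (dz 0 l).
Proof.
move=> [dzt <-]; split; first by have /derivable_mxP := dzt; apply.
by rewrite derive_mx// mxE.
Qed.

(** Since both methods share the nodes [c] and the weights [b], the coupling conditions of order
    three reduce to one condition for each coefficient matrix. *)
Lemma prk_order3 (R : realType) (s : nat) (a a' : 'M[R]_s) (b : 'rV[R]_s)
  (c : 'I_s -> R) :
  (forall i, \sum_j a i j = c i) ->
  (forall i, \sum_j strict_lower a' i j = c i) ->
  \sum_i b 0 i = 1 ->
  \sum_i b 0 i * c i = 2^-1 ->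
  \sum_i b 0 i * c i ^+ 2 = 3^-1 ->
  \sum_i b 0 i * \sum_j a i j * c j = 6^-1 ->
  \sum_i b 0 i * \sum_j strict_lower a' i j * c j = 6^-1 ->
  prk_order a b a' b 3.
Proof.
move=> ac a'c b1 bc bcc bac ba'c; exists 3%N => m n g f g3 f3 y0.
split; first by apply: prk_map_exist; [exact: Cn_le g3|exact: Cn_le f3].
move=> Phi z v [k [k' [kc k'c PhiE]]] [y0E dzv].
have F3 := join_fun_Cn g3 f3.
have [L [Q FT]] := C3_taylor2 (join y0) F3.
pose al := joint_coef (m := m) (n := n) a a'.
have alc l i : \sum_j al l i j = c i by rewrite /al /joint_coef; case: ifP.
have albac l : \sum_i b 0 i * \sum_j al l i j * c j = 6^-1.
  by rewrite /al /joint_coef; case: ifP.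
pose K h := join_stages (fun i => k i (h, y0)) (fun i => k' i (h, y0)).
have /near_prodP[r r0 rP] := PhiE.
have stepE : \forall h \near (0 : R),
    K h = stage_rhs al (join_fun g f) h (join y0) (K h) /\
    join (Phi h y0) = join y0 + h *: \sum_i b 0 i *: row i (K h).
  apply/nbhs_normP; exists r => //= h /=; rewrite sub0r normrN => hr.
  by apply/prk_stepE; apply: (rP h y0) => //; rewrite subrr normr0.
(* Boundedness of the stages near [h = 0] comes from their assumed continuity at [(0, y0)]. *)
have KO : isO 0 K.
  apply: isO_mx => i.
  apply: (@isO_le _ _ _ (`|k i (0, y0)| + 1 + (`|k' i (0, y0)| + 1))).
  have /near_prodP[r1 r10 r1P] : \forall p \near ((0 : R), y0), `|k i (0,
    y0) - k i p| <= 1.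
    exact: (cvgrPdist_le _ _).1 (kc i) 1 ltr01.
  have /near_prodP[r2 r20 r2P] : \forall p \near ((0 : R), y0), `|k' i (0,
    y0) - k' i p| <= 1.
    exact: (cvgrPdist_le _ _).1 (k'c i) 1 ltr01.
  apply/nbhs_normP; exists (minr r1 r2) => /=; first by rewrite lt_min r10.
  move=> h /=; rewrite sub0r normrN lt_min => /andP[h1 h2].
  have y00 e : 0 < e -> `|y0 - y0| < e by rewrite subrr normr0.
  have := norm_le_dist (r1P h y0 h1 (y00 _ r10)).
  have := norm_le_dist (r2P h y0 h2 (y00 _ r20)).
  rewrite rowK expr0 mulr1 norm_join prod_normE ge_max /= => k2 k1.
  by apply/andP; split; [rewrite ler_wpDr|rewrite ler_wpDl]; rewrite ?addr_ge0.
have KE : \forall h \near (0 : R),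
    K h = stage_rhs al (join_fun g f) h (join y0) (K h).
  by apply: filterS stepE => h [].
have num := numerical_expansion alc b1 bc bcc albac FT KO KE.
have dY : \forall t \near (0 : R), forall l, is_derive t (1 : R)
    (fun s => join (z s, v s) 0 l) (join_fun g f (join (z t, v t)) 0 l).
  apply: filterS dzv => t [dz dv] l; rewrite /join_fun joinK.
  case: (split_ordP l) => j ->.
    rewrite row_mxEl; under [X in is_derive _ _ X]funext do rewrite row_mxEl.
    exact: is_derive_coord.
  rewrite row_mxEr; under [X in is_derive _ _ X]funext do rewrite row_mxEr.
  exact: is_derive_coord.
have cF : {for join y0, continuous (join_fun g f)} by exact: Cn_continuous F3 _.
have Y0 : join (z 0, v 0) = join y0 by rewrite y0E.
have ex := exact_expansion FT Y0 cF dY.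
have [C C0 CP] := isOD num (isOZ (-1) ex).
(* The constant must be positive here, while [C] may be 0. *)
apply/eqO_exP; exists (C + 1); first by rewrite ltr_wpDl.
apply: cvg_within.
apply: filterS2 CP stepE => h CP [_ PE].
rewrite -norm_join -joinB PE normrX.
apply: (@le_trans _ _ (C * `|h| ^+ 4));
  last by rewrite ler_wpM2r ?exprn_ge0// lerDl.
move: CP; set x := h *: _; set y := join (z h, v h);
  set j := flow_jet _ _ _ _ _.
have -> : x - j + -1 *: (y - join y0 - j) = join y0 + x - y
  by apply/rowP => l; rewrite !mxE; ring.
by [].
Qed.

(** * Differentiability of the stages in the initial value *)

Section DifferentialEps.
Context {R : realType} {V W : normedModType R}.

Lemma is_diff_eps (f : V -> W) (df : {linear V -> W}) x : continuous df ->
  (forall eps : R, 0 < eps ->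
     \forall u \near (0 : V), `|f (x + u) - f x - df u| <= eps * `|u|) ->
  differentiable f x /\ 'd f x = df :> (V -> W).
Proof.
move=> dfc fe.
have fE : f \o shift x = cst (f x) + df +o_ (0 : V) id.
  apply/eqaddoP => eps eps0; apply: filterS (fe _ eps0) => u; apply: le_trans.
  by rewrite -[X in `|X| <= _]/(f (u + x) - (f x + df u))
    [u + x]addrC opprD addrA.
have dE := diff_unique dfc fE; split => //.
by apply/diff_locallyP; rewrite dE.
Qed.

Lemma diff_eps (f : V -> W) x : differentiable f x ->
  forall eps : R, 0 < eps ->
    \forall u \near (0 : V), `|f (x + u) - f x - 'd f x u| <= eps * `|u|.
Proof.
move=> /diff_locallyP[_ /eqaddoP fE] eps eps0; apply: filterS (fE _ eps0) => u.
apply: le_trans.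
by rewrite le_eqVlt; apply/orP; left; apply/eqP; congr (`|_|);
  rewrite [x + u]addrC -addrA -opprD.
Qed.

End DifferentialEps.

Section StageDifferential.
Context {R : realType} {s d : nat}.
Variables (al : 'I_d -> 'M[R]_s) (F : 'rV[R]_d -> 'rV[R]_d) (y0 : 'rV[R]_d).
Hypothesis F1 : Cn 1 F.
Let K0 : 'M[R]_(s, d) := \matrix_i F y0.
Variables (r rho : R).
Hypothesis r0 : 0 < r.
Hypothesis dFr : forall x v, `|x - y0| < r -> `|'d F x v| <= r^-1 * `|v|.
Hypothesis str : forall h y K i,
  `|h| < rho -> `|y - y0| < rho -> `|K - K0| <= 1 ->
  `|stage al y h K i - y0| <= r / 2.
Hypothesis st0 : forall h K i,
  `|h| < rho -> `|stage al 0 h K i| <= r / 2 * `|K|.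
Variables (h : R) (y : 'rV[R]_d) (K : 'rV[R]_d -> 'M[R]_(s, d)).
Hypothesis hr : `|h| < rho.
Hypothesis yr : `|y - y0| < rho.
Hypothesis KE : \forall y' \near y,
  `|K y' - K0| <= 1 /\ K y' = stage_rhs al F h y' (K y').

Let Y i := stage al y h (K y) i.

(** The linearized stage map halves distances on the whole matrix space. Its fixed point is
    therefore unique, and uniqueness makes it depend linearly on [u]. *)
Lemma linearized_stages_exist : exists kap : {linear 'rV[R]_d -> 'M[R]_(s, d)},
  forall u i, row i (kap u) = 'd F (Y i) (stage al u h (kap u) i).
Proof.
have [KK _] := nbhs_singleton KE.
have rV : 0 <= r^-1 by rewrite invr_ge0 ltW.
have Yr i : `|Y i - y0| < r.
  by rewrite (le_lt_trans (str i hr yr KK))// ltr_pdivrMr//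
    mulr_natr mulr2n ltrDl.
pose D i : {linear 'rV[R]_d -> 'rV[R]_d} := 'd F (Y i).
have Dr i v : `|D i v| <= r^-1 * `|v| by exact: dFr.
pose T u (k : 'M[R]_(s, d)) : 'M[R]_(s, d) := \matrix_i D i (stage al u h k i).
have TC u k k' : `|T u k - T u k'| <= 2^-1 * `|k - k'|.
  apply: mx_norm_rows => [|i]; first by rewrite mulr_ge0// invr_ge0.
  rewrite raddfB /= !rowK -linearB stageB subrr (le_trans (Dr _ _))//.
  rewrite (@le_trans _ _ (r^-1 * (r / 2 * `|k - k'|)))//.
    by rewrite ler_wpM2l// st0.
  by rewrite mulrA mulrA mulVf ?gt_eqF// mul1r.
have /choice[kap kapE] u : exists k, k = T u k.
  (* With this radius the centre 0 moves by exactly half the radius. *)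
  have [|||k _ kE] := @contraction_ball _ _ _ (T u) 0 (2 * `|T u 0|).
  - by rewrite mulr_ge0.
  - by rewrite subr0 mulrAC divff// mul1r.
  - by move=> k k' _ _; exact: TC.
  - by exists k.
have uniq u k : k = T u k -> k = kap u.
  move=> kE; have := TC u k (kap u); rewrite -kE -kapE => le2.
  apply/eqP; rewrite -subr_eq0 -normr_le0; move: le2 (normr_ge0 (k - kap u)).
  by set x := `|_|; lra.
have kap_lin : linear kap.
  move=> a u v; apply/esym/uniq; apply/row_matrixP => i.
  rewrite rowK stage_linear linearP [in RHS]linearD /= linearZ /=.
  by rewrite {1}(kapE u) {1}(kapE v) !rowK.
have [L LE] := linear_pack kap_lin; exists L => u i.
by rewrite -LE {1}kapE rowK.
Qed.

(** Subtracting the stage equations at [y + u] and [y] bounds the increment of the stages by a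
    multiple of [|u|]. Its error against [kap u] solves the homogeneous linearized equations up to
    the Taylor remainder of [F], and contractivity bounds the error by twice that remainder. *)
Lemma stages_differentiable (kap : {linear 'rV[R]_d -> 'M[R]_(s, d)}) :
  (forall u i, row i (kap u) = 'd F (Y i) (stage al u h (kap u) i)) ->
  differentiable K y /\ 'd K y = kap :> ('rV[R]_d -> 'M[R]_(s, d)).
Proof.
move=> kapE.
have [KK KyE] := nbhs_singleton KE.
have rV : 0 <= r^-1 by rewrite invr_ge0 ltW.
have Yr i : `|Y i - y0| < r.
  by rewrite (le_lt_trans (str i hr yr KK))// ltr_pdivrMr//
    mulr_natr mulr2n ltrDl.
pose D i : {linear 'rV[R]_d -> 'rV[R]_d} := 'd F (Y i).
have Dr i v : `|D i v| <= r^-1 * `|v| by exact: dFr.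
apply: is_diff_eps => [|eps eps0]; first exact: linear_rV_continuous.
(* The stage values move by at most [2 * |u|], and absorbing half of the error doubles the bound
   once more; hence the division by 4. *)
have e4 : 0 < eps / 4 by rewrite divr_gt0.
have FD : \forall v \near (0 : 'rV[R]_d), forall i : 'I_s,
    `|F (Y i + v) - F (Y i) - D i v| <= eps / 4 * `|v|.
  have /filter_forall : forall i : 'I_s, \forall v \near (0 : 'rV[R]_d),
      `|F (Y i + v) - F (Y i) - D i v| <= eps / 4 * `|v|.
    by move=> i; exact: diff_eps (F1.1 (Y i)) _ e4.
  by [].
have /nbhs_normP[q /= q0 qP] := FD.
have /nbhs_normP[t /= t0 tP] := KE.
apply/nbhs_normP; exists (minr (q / 2) (minr t (rho - `|y - y0|))) => /=.
  by rewrite !lt_min divr_gt0// t0 subr_gt0 yr.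
move=> u /=; rewrite sub0r normrN !lt_min => /andP[uq /andP[ut urho]].
have [KuK KuE] : `|K (y + u) - K0| <= 1 /\ K (y + u)
  = stage_rhs al F h (y + u) (K (y + u)).
  by apply: tP; rewrite /= opprD addrA subrr sub0r normrN.
have yur : `|y + u - y0| < rho.
  by rewrite addrAC (le_lt_trans (ler_normD _ _))// -ltrBrDl.
pose dK := K (y + u) - K y.
have dKu : `|dK| <= 2 * r^-1 * `|u|.
  have := stage_rhs_lipschitz F1 r0 dFr str st0 hr yur yr KuK KK.
  rewrite -KuE -KyE -/dK [y + u]addrC addrK.
  by set x := `|dK|; set z := `|u|; rewrite -mulrA; set w := r^-1 * z; lra.
pose v i := stage al u h dK i.
have YvE i : stage al (y + u) h (K (y + u)) i = Y i + v i.
  have yu : y + u - y = u by rewrite addrAC subrr add0r.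
  have := stageB al (y + u) h (K (y + u)) y (K y) i.
  by rewrite yu /v => <-; rewrite [RHS]addrC subrK.
have vu i : `|v i| <= 2 * `|u|.
  rewrite /v stage_shift (le_trans (ler_normD _ _))// mulr_natl mulr2n lerD2l.
  rewrite (le_trans (st0 _ _ hr))//
    (@le_trans _ _ (r / 2 * (2 * r^-1 * `|u|)))//.
    by rewrite ler_wpM2l// divr_ge0// ltW.
  have -> : r / 2 * (2 * r^-1 * `|u|) = `|u| by field; rewrite gt_eqF.
  by [].
have vq i : `|v i| < q.
  by rewrite (le_lt_trans (vu i))// mulrC -ltr_pdivlMr.
pose e := dK - kap u.
have eE i : row i e = (F (Y i + v i) - F (Y i) - D i (v i))
  + D i (stage al 0 h e i).
  have -> : stage al 0 h e i = v i - stage al u h (kap u) i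
    by rewrite /v stageB subrr.
  have -> : D i (v i - stage al u h (kap u) i) = D i (v i)
    - D i (stage al u h (kap u) i).
    exact: linearB.
  rewrite addrA subrK /e !raddfB /= {1}KuE {1}KyE !rowK YvE kapE.
  by [].
have eb : `|e| <= eps / 2 * `|u| + 2^-1 * `|e|.
  apply: mx_norm_rows => [|i].
    by rewrite addr_ge0// mulr_ge0// ?divr_ge0 ?invr_ge0// ltW.
  rewrite eE (le_trans (ler_normD _ _))// lerD//.
    have qv : `|0 - v i| < q by rewrite sub0r normrN.
    rewrite (le_trans (qP _ qv i))// [leRHS](_ : _ = eps / 4 * (2 * `|u|)).
      by rewrite ler_wpM2l// ltW.
    by field.
  rewrite (le_trans (Dr _ _))// (@le_trans _ _ (r^-1 * (r / 2 * `|e|)))//.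
    by rewrite ler_wpM2l// st0.
  by rewrite mulrA mulrA mulVf ?gt_eqF// mul1r.
rewrite -/dK -/e; move: eb; rewrite [eps / 2 * _]mulrAC.
by set x := `|e|; set z := eps * _; lra.
Qed.

End StageDifferential.

(** * Symplecticity *)

Section SymplecticForm.
Context {R : realType} {n : nat}.
Local Notation J := (@canonical_J R n).
Implicit Types u v w : 'rV[R]_(n + n).

Definition sform u v : R := (u *m J *m v^T) 0 0.

Lemma sform_linear_l v : linear (sform^~ v : _ -> R).
Proof. by move=> a u w; rewrite /sform !mulmxDl -!scalemxAl !mxE. Qed.

Lemma tr_canonical_J : J^T = - J.
Proof.
rewrite /canonical_J tr_block_mx !trmx0 linearN /= !trmx1 opp_block_mx.
by rewrite !oppr0 opprK.
Qed.

Lemma canonical_J_sqr : J *m J = - 1%:M.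
Proof.
rewrite /canonical_J mulmx_block !(mulmx0, mul0mx, mulmx1, mul1mx, addr0,
  add0r).
by rewrite scalar_mx_block opp_block_mx !oppr0.
Qed.

Lemma sform_sym u v : sform u v = - sform v u.
Proof.
have -> : sform u v = (u *m J *m v^T)^T 0 0 by rewrite mxE.
by rewrite !trmx_mul trmxK tr_canonical_J mulNmx mulmxN mxE mulmxA.
Qed.

Lemma sform_sum_l (s : nat) (h : R) (c : 'I_s -> R) u (x : 'I_s ->
  'rV[R]_(n + n)) w :
  sform (u + h *: \sum_i c i *: x i)
    w = sform u w + h * \sum_i c i * sform (x i) w.
Proof.
have [L LE] := linear_pack (sform_linear_l w).
rewrite -![sform _ w]/((sform^~ w) _) LE linearD linearZ linear_sum /=.
by congr (_ + _ * _); apply: eq_bigr => i _; rewrite linearZ -LE.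
Qed.

Lemma sform_sum_r (s : nat) (h : R) (c : 'I_s -> R) u (x : 'I_s ->
  'rV[R]_(n + n)) w :
  sform w (u + h *: \sum_i c i *: x i)
    = sform w u + h * \sum_i c i * sform w (x i).
Proof.
by rewrite sform_sym sform_sum_l sform_sym opprD opprK -mulrN -sumrN;
  congr (_ + _ * _); apply: eq_bigr => i _; rewrite -mulrN -sform_sym.
Qed.

(** The entries of the two matrices are the values of the form on pairs of basis vectors. The
    transpose is due to [lin1_mx] acting on row vectors from the right. *)
Lemma symplectic_mxP (f : {linear 'rV[R]_(n + n) -> 'rV[R]_(n + n)}) :
  (forall u v, sform (f u) (f v) = sform u v) -> symplectic_mx (lin1_mx f)^T.
Proof.
move=> fS; rewrite /symplectic_mx trmxK.
have entry (M : 'M[R]_(n + n)) i j :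
    M i j = ((delta_mx 0 i : 'rV_(n + n))
      *m M *m (delta_mx 0 j : 'rV_(n + n))^T) 0 0.
  by rewrite -rowE trmx_delta -colE !mxE.
apply/matrixP => i j; rewrite entry [RHS]entry -/(sform _ _) -fS /sform.
by rewrite -!mul_rV_lin1 trmx_mul !mulmxA.
Qed.

(* Writing [w] and [u] as the stage values minus their increments, the terms of
   first order in [h] cancel by the second hypothesis, and what is left is
   [h ^+ 2] times the sum of
   [(b i * b j - b i * a i j - b j * a j i) * sform (x i) (z j)]. *)
Lemma sform_step (s : nat) (a : 'M[R]_s) (b : 'I_s -> R) (h : R) u w
    (x z : 'I_s -> 'rV[R]_(n + n)) :
  (forall i j, b i * a i j + b j * a j i = b i * b j) ->
  (forall i, sform (x i) (w + h *: \sum_j a i j *: z j) +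
             sform (u + h *: \sum_j a i j *: x j) (z i) = 0) ->
  sform (u + h *: \sum_i b i *: x i) (w + h *: \sum_i b i *: z i) = sform u w.
Proof.
move=> ab inv; rewrite sform_sum_l !sform_sum_r -addrA.
under [X in _ + (_ + _ * X)]eq_bigr do rewrite sform_sum_r.
pose S := \sum_i b i * (sform (x i) w + sform u (z i)).
pose T := \sum_i \sum_j b i * b j * sform (x i) (z j).
have -> : h * (\sum_i b i * sform u (z i)) +
    h * (\sum_i b i * (sform (x i) w + h * \sum_j b j * sform (x i) (z j)))
      = h * (S + h * T).
  rewrite -mulrDr; congr (_ * _);
    rewrite -big_split /= /S /T mulr_sumr -big_split /=.
  apply: eq_bigr => i _.
  rewrite [in RHS](eq_bigr (fun j => b i * (b j * sform (x i) (z j))));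
    last by move=> j _; rewrite mulrA.
  by rewrite -mulr_sumr; ring.
suff -> : S = - (h * T) by rewrite addNr mulr0 addr0.
have SE i : sform (x i) w + sform u (z i) =
    - (h * \sum_j (a i j * sform (x i) (z j) + a i j * sform (x j) (z i))).
  have := inv i; rewrite sform_sum_l sform_sum_r big_split /= => e.
  by apply/eqP; rewrite -subr_eq0; apply/eqP; rewrite -[RHS]e; ring.
rewrite /S (eq_bigr (fun i => - h * (\sum_j b i * a i j * sform (x i) (z j) +
    \sum_j b i * a i j * sform (x j) (z i)))); last first.
  move=> i _; rewrite SE -big_split /= mulrN mulNr; congr (- _).
  rewrite mulrCA; congr (_ * _); rewrite mulr_sumr; apply: eq_bigr => j _; ring.
rewrite -mulr_sumr mulNr; congr (- (_ * _)).
(* Exchanging the indices in the second double sum gives both sums the common factor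
   [sform (x i) (z j)], with coefficients adding up to the left side of [ab]. *)
rewrite big_split /= [X in _ + X]exchange_big /= -big_split /= /T.
apply: eq_bigr => i _; rewrite -big_split /=; apply: eq_bigr => j _.
by rewrite -ab; ring.
Qed.

End SymplecticForm.

(** * Hamiltonian vector fields *)

Section Hamiltonian.
Context {R : realType}.

Lemma Cn_cst (V W : normedModType R) N (c : W) : Cn N (fun _ : V => c).
Proof.
elim: N c => [|N IH] c /=; first by move=> x; exact: cvg_cst.
split=> [x|u]; first exact: differentiable_cst.
rewrite (_ : (fun x => _) = (fun=> 0)); first exact: IH.
by apply/funext => x; rewrite (congr1 (fun f => f u) (diff_cst c x)).
Qed.

Lemma Cn_sum (V W : normedModType R) N (I : Type) (r : seq I) (f : I ->
  V -> W) :
  (forall i, Cn N (f i)) -> Cn N (fun x => \sum_(i <- r) f i x).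
Proof.
move=> fN; elim: r => [|i r IH].
  by rewrite (_ : (fun x => _) = (fun=> 0));
    [exact: Cn_cst|apply/funext => x; rewrite big_nil].
rewrite (_ : (fun x => _) = f i + (fun x => \sum_(j <- r) f j x));
  first exact: CnD.
by apply/funext => x; rewrite big_cons.
Qed.

Lemma Cn_row (V : normedModType R) d N (f : 'I_d -> V -> R) :
  (forall l, Cn N (f l)) -> Cn N (fun x => \row_l f l x).
Proof.
move=> fN.
have ll l : linear (fun t : R => t *: (delta_mx 0 l : 'rV[R]_d)).
  by move=> a x y; rewrite scalerDl scalerA.
rewrite (_ : (fun x => _) = (fun x =>
  \sum_l f l x *: (delta_mx 0 l : 'rV[R]_d))).
  apply: Cn_sum => l; have [L LE] := linear_pack (ll l).
  rewrite (_ : (fun x => _) = L \o f l); last by rewrite -LE.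
  by apply: Cn_comp_linear_l => //; rewrite -LE; exact: scalel_continuous.
by apply/funext => x; rewrite [LHS]row_sum_delta; apply: eq_bigr => l _;
  rewrite mxE.
Qed.

Variables (n : nat) (H : 'rV[R]_(n + n) -> R).
Hypothesis H2 : Cn 2 H.

Let G (y : 'rV[R]_(n + n)) : 'rV[R]_(n + n) := \row_l 'd H y (delta_mx 0 l).

(** This factorization reduces the smoothness and the differential of the field to those of the
    partial derivatives of [H]. *)
Lemma hamiltonian_fieldE : exists2 L : {linear 'rV[R]_(n + n) ->
  'rV[R]_(n + n)},
  (forall u, L u = (canonical_J n *m u^T)^T) & hamiltonian_field H = L \o G.
Proof.
have Ll : linear (fun u : 'rV[R]_(n + n) => (canonical_J n *m u^T)^T).
  by move=> a u v; rewrite !linearP.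
have [L LE] := linear_pack Ll; exists L; first by move=> u; rewrite -LE.
apply/funext => y; rewrite /= -LE /hamiltonian_field; congr ((_ *m _)^T).
by apply/colP => i; rewrite !mxE deriveE//; exact: H2.1.
Qed.

Lemma hamiltonian_field_C1 : Cn 1 (hamiltonian_field H).
Proof.
have [L _ ->] := hamiltonian_fieldE.
apply: Cn_comp_linear_l; first exact: linear_rV_continuous.
by apply: Cn_row => l; exact: H2.2.
Qed.

(** The matrix [J] of the field and that of the form cancel, because [J^T *m J] is the identity.
    What remains is the Hessian of [H]. *)
Lemma sform_hamiltonian y v w :
  sform ('d (hamiltonian_field H) y v) w = diff2 H y w v.
Proof.
have [L LE ->] := hamiltonian_fieldE.
have G1 : Cn 1 G by apply: Cn_row => l; exact: H2.2.
have dL x : differentiable L x by apply: linear_differentiable;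
  exact: linear_rV_continuous.
have h := diff_comp (G1.1 y) (dL (G y)).
rewrite (congr1 (fun f => f v) h) /=.
rewrite (congr1 (fun f =>
  f ('d G y v)) (diff_lin (G y) (@linear_rV_continuous _ _ _ L))).
have JJ (u : 'rV[R]_(n + n)) : u *m (- canonical_J n) *m canonical_J n = u.
  by rewrite mulmxN mulNmx -mulmxA canonical_J_sqr mulmxN opprK mulmx1.
rewrite LE /sform trmx_mul trmxK tr_canonical_J JJ.
have d2H u : differentiable (fun z => 'd H z u) y by case: (H2.2 u).
have [D DE] := linear_pack (diff2_linear_l v d2H).
rewrite -[RHS]/((fun w => diff2 H y w v) w) DE [RHS](linear_delta D w) mxE.
apply: eq_bigr => l _; rewrite -DE mxE mulrC; congr (_ * _).
have [_ <-] := is_diff_coord 0 l (G1.1 y).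
rewrite /diff2 (_ : (fun z => G z 0 l) = fun z => 'd H z (delta_mx 0 l))//.
by apply/funext => z; rewrite mxE.
Qed.

Lemma hamiltonian_field_sform y v w :
  sform ('d (hamiltonian_field H) y v) w + sform v ('d (hamiltonian_field H)
    y w) = 0.
Proof.
by rewrite [X in _ + X]sform_sym !sform_hamiltonian (diff2_sym _ _ _ H2) subrr.
Qed.

End Hamiltonian.

(** * Symplecticity of Runge--Kutta steps *)

Section RungeKutta.
Context {R : realType} {s : nat}.
Variables (a : 'M[R]_s) (b : 'rV[R]_s).

Lemma rk_stageE d (y : 'rV[R]_d) h K i :
  stage (fun=> a) y h K i = y + h *: \sum_j a i j *: row j K.
Proof.
apply/rowP => l; rewrite !mxE summxE; congr (_ + _ * _).
by apply: eq_bigr => j _; rewrite !mxE.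
Qed.

Lemma rk_stepE d (F : 'rV[R]_d -> 'rV[R]_d) h y (k : 'I_s -> 'rV[R]_d) y1 :
  rk_step a b F h y k y1 <->
  \matrix_i k i = stage_rhs (fun=> a) F h y (\matrix_i k i) /\
  y1 = y + h *: \sum_i b 0 i *: row i (\matrix_i k i : 'M[R]_(s, d)).
Proof.
rewrite /rk_step.
rewrite (eq_bigr (fun i => b 0 i *: row i (\matrix_i k i : 'M[R]_(s, d))));
  last first.
  by move=> i _; rewrite rowK.
have st i : stage (fun=> a) y h (\matrix_i k i)
  i = y + h *: \sum_j a i j *: k j.
  by rewrite rk_stageE; congr (_ + _ *: _); apply: eq_bigr => j _; rewrite rowK.
split=> -[kE ->]; split => //.
  by apply/row_matrixP => i; rewrite !rowK st.
by move=> i; have := congr1 (row i) kE; rewrite !rowK st.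
Qed.

Lemma rk_map_exist d (F : 'rV[R]_d -> 'rV[R]_d) y0 : Cn 1 F ->
  exists Phi, rk_map a b F y0 Phi.
Proof.
move=> F1; have [k kc kE] := stages_exist (fun=> a) y0 F1.
exists (fun h y => y + h *: \sum_i b 0 i *: row i (k (h, y))),
  (fun i p => row i (k p)); split.
  move=> i; apply/cvgrPdist_le => e e0.
  have ke : \forall p \near ((0 : R), y0), `|k (0, y0) - k p| <= e.
    exact: (cvgrPdist_le _ _).1 kc e e0.
  by apply: filterS ke => p; apply: le_trans; rewrite -raddfB;
    exact: row_norm_le.
apply: filterS kE => -[h y] /= KE; apply/rk_stepE.
have -> : \matrix_i row i (k (h, y)) = k (h, y) by apply/row_matrixP => i;
  rewrite rowK.
by split.
Qed.

Lemma rk_symplecticP :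
  (forall i j, b 0 i * a i j + b 0 j * a j i = b 0 i * b 0 j) ->
    rk_symplectic a b.
Proof.
move=> ab n H Hinf y0; have H2 := Hinf 2%N.
have F1 := hamiltonian_field_C1 H2; set F := hamiltonian_field H in F1 *.
split; first exact: rk_map_exist.
move=> Phi [k [kc PhiE]].
have [r [rho [r0 rho0] [dFr str st0]]] := stage_region (s := s) (fun=> a) y0 F1.
pose K p : 'M[R]_(s, n + n) := \matrix_i k i p.
pose K0 : 'M[R]_(s, n + n) := \matrix_i F y0.
(* At [h = 0] the stage equation fixes the stages. Continuity then keeps them within distance 1 of
   [K0], in the region of contractivity. *)
have k0 i : k i (0, y0) = F y0.
  by have [/(_ i) + _] := nbhs_singleton PhiE; rewrite /= scale0r addr0.
have KE : \forall p \near ((0 : R), y0), `|K p - K0| <= 1 /\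
    K p = stage_rhs (fun=> a) F p.1 p.2 (K p) /\
    Phi p.1 p.2 = p.2 + p.1 *: \sum_i b 0 i *: row i (K p).
  have /filter_forall kF : forall i, \forall p \near ((0 : R), y0), `|k i (0,
    y0) - k i p| <= 1.
    by move=> i; exact: (cvgrPdist_le _ _).1 (kc i) 1 ltr01.
  apply: filterS2 kF PhiE => p kp /rk_stepE stp; split => //.
  apply: mx_norm_rows => // i; rewrite raddfB /= !rowK distrC -(k0 i);
    exact: kp.
have /near_prodP[r1 r10 r1P] := KE.
apply/near_prodP; exists (minr rho r1); first by rewrite lt_min rho0.
move=> h y; rewrite !lt_min => /andP[hr h1] /andP[yr y1] /=.
have Ky : \forall y' \near y, `|K (h, y') - K0| <= 1 /\
    K (h, y') = stage_rhs (fun=> a) F h y' (K (h, y')) /\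
    Phi h y' = y' + h *: \sum_i b 0 i *: row i (K (h, y')).
  apply/nbhs_normP; exists (r1 - `|y - y0|) => /=; first by rewrite subr_gt0.
  move=> y' /= yy'; apply: (r1P h y' h1).
  rewrite (le_lt_trans (ler_distD y _ _))// distrC -ltrBrDr//.
have Ky1 : \forall y' \near y, `|K (h, y') - K0| <= 1 /\
    K (h, y') = stage_rhs (fun=> a) F h y' (K (h, y')).
  by apply: filterS Ky => y' [? []].
have [kap kapE] := linearized_stages_exist r0 dFr str st0 hr yr Ky1.
have [dK dKE] := stages_differentiable F1 r0 dFr str st0 hr yr Ky1 kapE.
pose df u := u + h *: \sum_i b 0 i *: row i (kap u).
pose B (M : 'M[R]_(s, n + n)) := h *: \sum_i b 0 i *: row i M.
have Bl : linear B.
  move=> c M M'; rewrite /B.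
  rewrite (eq_bigr (fun i => c *: (b 0 i *: row i M) + b 0 i *: row i M')).
    by rewrite big_split /= -scaler_sumr scalerDr !scalerA mulrC.
  by move=> i _; rewrite !linearP !scalerA mulrC.
have dfl : linear df.
  by move=> c u v; rewrite /df -!/(B _) linearP Bl scalerDr addrACA.
have [L LE] := linear_pack dfl.
have [dPhi dPhiE] : differentiable (Phi h) y /\
    'd (Phi h) y = L :> ('rV[R]_(n + n) -> 'rV[R]_(n + n)).
  apply: is_diff_eps => [|e e0]; first exact: linear_rV_continuous.
  (* [C] bounds the linear map [B], through which the error of the stages enters the step. Dividing
     by [C + 1] below is safe even if [C] is 0. *)
  pose C := `|h| * \sum_i `|b 0 i|.
  have C0 : 0 <= C by rewrite mulr_ge0// sumr_ge0.
  have BC M : `|B M| <= C * `|M|.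
    rewrite normrZ -mulrA ler_wpM2l// (le_trans (ler_norm_sum _ _ _))//
      mulr_suml.
    by apply: ler_sum => i _; rewrite normrZ ler_wpM2l// row_norm_le.
  have eC : 0 < e / (C + 1) by rewrite divr_gt0// ltr_wpDl.
  have Py := nbhs_singleton Ky.
  have Pyu : \forall u \near (0 : 'rV[R]_(n + n)),
      Phi h (y + u) = y + u + B (K (h, y + u)).
    by apply: filterS ((nbhs0P _ _).1 Ky) => u [_ []].
  apply: filterS2 Pyu (diff_eps dK eC) => u -> Ke.
  rewrite -LE /df -/(B _) Py.2.2 -/(B _).
  have [BL BLE] := linear_pack Bl.
  have -> : y + u + B (K (h, y + u)) - (y + B (K (h, y))) - (u + B (kap u)) =
      B (K (h, y + u) - K (h, y) - kap u).
    rewrite BLE !linearB /=.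
    by apply/rowP => l; rewrite !mxE; ring.
  rewrite (le_trans (BC _))// (@le_trans _ _ (C * (e / (C + 1) * `|u|)))//.
    by rewrite ler_wpM2l//; move: Ke; rewrite dKE.
  rewrite mulrA ler_wpM2r// mulrCA ler_piMr ?(ltW e0)//.
  by rewrite ler_pdivrMr ?mul1r ?lerDl// ltr_wpDl.
split => //.
have -> : jacobian (Phi h) y = lin1_mx L.
  by apply/row_matrixP => i; rewrite !rowE !mul_rV_lin1 dPhiE.
apply: symplectic_mxP => u w; rewrite -LE /df.
apply: sform_step => [i j|i]; first exact: ab.
(* For each [i] both linearized stages are images under the differential of the field at the same
   stage value, so its infinitesimal symplecticity applies. *)
rewrite -!rk_stageE !kapE; exact: hamiltonian_field_sform.
Qed.

End RungeKutta.

(** * The coefficients *)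

Section GaussCoefficients.
Variable R : realType.

Let r3 := Num.sqrt 3 : R.

Let r3_sqr : r3 * r3 = 3.
Proof. by rewrite -expr2 sqr_sqrtr. Qed.

Let r3_neq : 3 - r3 != 0.
Proof.
apply/negP => /eqP e; have e3 : r3 = 3 by lra.
by move: r3_sqr; rewrite e3; lra.
Qed.

(** Rationalizing the denominator makes the order conditions polynomial in [r3], to be settled by
    [r3 * r3 = 3]. The value is also the last Gauss node. *)
Lemma inv_3_sub_sqrt3 : (3 - r3)^-1 = 1 / 2 + r3 / 6.
Proof.
apply: (mulfI r3_neq); rewrite divff//.
have := r3_sqr; lra.
Qed.

Let sumE (F : 'I_3 -> R) : \sum_i F i = F 0 + F 1 + F 2%:R.
Proof.
rewrite !big_ord_recl big_ord0 addr0 addrA; congr (_ + F _ + F _);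
  exact/val_inj.
Qed.

Lemma gauss_prk_order3 : prk_order (aZ R) (bZ R) (aU R) (bU R) 3.
Proof.
(* The nodes are the row sums of [aZ], and those of [aU] agree with them. [bU] unfolds to the same
   matrix as [bZ], so a single weight vector serves both methods. *)
apply: (@prk_order3 _ _ _ _ _ (fun i => \sum_j aZ R i j)) => //;
  rewrite ?sumE; do ?[case=> [[|[|[|//]]]] ?];
  rewrite ?sumE !mxE /= -?/r3 ?inv_3_sub_sqrt3; have := r3_sqr; try lra; nra.
Qed.

Lemma gauss_rk_symplectic : rk_symplectic (aZ R) (bZ R).
Proof.
apply: rk_symplecticP.
by do 2! [case=> [[|[|[|//]]]] ?]; rewrite !mxE /= -?/r3; field.
Qed.

End GaussCoefficients.

Theorem lemmaA2 (R : realType) :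
  prk_order (aZ R) (bZ R) (aU R) (bU R) 3 /\ rk_symplectic (aZ R) (bZ R).
Proof. by split; [exact: gauss_prk_order3|exact: gauss_rk_symplectic]. Qed.
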